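(* Let $\mathcal D$ be a filtered $\varphi$-module with pairwise distinct Hodge–Tate weights and with $\varphi$ diagonalizable over $\mathbb Q_p$. Let $\mathcal F_\bullet$ be a refinement of $\mathcal D$, $\mathcal B=(v_1,\dots,v_d)$ a basis adapted to the filtration with $\mathcal F_i=\langle v_1,\dots,v_i\rangle$, and $\mathcal B_0=(e_1,\dots,e_d)$ a basis of eigenvectors, $\varphi e_i=\alpha_ie_i$, with $\mathcal F_i=\langle e_1,\dots,e_i\rangle$, such that the matrix $P=(\lambda_{i,j})$ of $\mathcal B$ in $\mathcal B_0$ is upper triangular unipotent. Let $J$ be a finite interval of $\mathbb Z$ containing $]t_{HT,1},t_{HT,d}]$ with $|J|>\max_{1\le i\le j\le d}\mathrm{ord}_p(\alpha_j/\alpha_i)$, and $N\ge0$. Then the sequence $Z_n$ converges to an endomorphism $Z_\infty$ whose matrix in $\mathcal B_0$ has entries that are polynomials of total degree $\le d-1$ in the $\lambda_{i,j}$ ($i<j$), with coefficients in $\mathcal H$ depending only on $N$, $J$, the $\alpha_i$ and the $t_{HT,i}$. The slope of the $\Lambda_{\mathbb Q_p}$-module generated by $Z_\infty(\mathcal D)$ is at most $\tilde\beta(|J|)+\max_{1\le i\le k\le d}(\mathrm{ord}_p(\alpha_k)-t_{HT,i})$.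
   Context: Let $p$ be an odd prime, $u$ a topological generator of $1+p\mathbb Z_p$, $\Lambda_{\mathbb Q_p}=\mathbb Q_p\otimes\mathbb Z_p[[x]]$. $\mathcal H$ is the ring of power series in $\mathbb Q_p[[x]]$ converging on the open unit disc of $\mathbb C_p$, $\|f\|_\rho=\sup_{|z|_p\le\rho}|f(z)|_p$, with its Fréchet topology. For $f\in\mathbb Q_p[[x]]$, $f^{(j)}(x)=f(u^{-j}(1+x)-1)$; $\omega_n=(1+x)^{p^n}-1$, $\xi_n=\omega_n/\omega_{n-1}$ ($n\ge1$), $\xi_0=px$; $\ell_n^S=\prod_{j\in S}\xi_n^{(j)}/p$. For a finite interval $J$, a subinterval $J'\subseteq J$ and $n\ge1$, $\tilde\xi_n^{J'\subset J}$ is the unique polynomial of degree $<((p-1)|J'|+|J|)p^{n-1}$ with $\tilde\xi_n^{J'\subset J}\equiv\xi_n^{(j)}/p\pmod{\omega_n^{(j)}}$ ($j\in J'$), $\equiv1\pmod{\omega_{n-1}^{(j)}}$ ($j\in J\setminus J'$); $\tilde\xi_0^{J'\subset J}=\ell_0^{J'}$; $\tilde\beta(s)=\lfloor(s-1)/(p-1)\rfloor$. A filtered $\varphi$-module $\mathcal D$ ($\dim d$, bijective linear $\varphi$, decreasing exhaustive separated filtration) has Hodge–Tate weights $t_{HT,1}\le\dots\le t_{HT,d}$ ($i$ with $\mathrm{Fil}^i\ne\mathrm{Fil}^{i+1}$, multiplicity $\dim\mathrm{Fil}^i/\mathrm{Fil}^{i+1}$); $]a,b]=\{j\in\mathbb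 Z:a<j\le b\}$; $\mathcal B$ is adapted to the filtration if $v_i\in\mathrm{Fil}^{t_{HT,i}}\mathcal D$. A refinement is a complete flag $\mathcal F_1\subset\dots\subset\mathcal F_d=\mathcal D$ ($\dim\mathcal F_i=i$) of $\varphi$-stable subspaces with $\mathcal F_i\cap\mathrm{Fil}^{t_{HT,i}}\mathcal D\ne0$ and $\mathcal F_i\cap\mathrm{Fil}^{t_{HT,i}+1}\mathcal D=0$ for all $i$. $T_n$ is the $\mathcal H$-linear endomorphism of $\mathcal H\otimes\mathcal D$ with $T_n(v_i)=\tilde\xi_n^{]t_{HT,i},t_{HT,d}]\subset J}v_i$; $Z_{N-1}=\mathrm{Id}$ and $Z_n=(1\otimes\varphi)^{n+1}T_n(1\otimes\varphi)^{-(n+1)}Z_{n-1}$ for $n\ge N$. Fix a basis $(b_k)$ of $\mathcal D$, $\|\sum g_k\otimes b_k\|_\rho=\max\|g_k\|_\rho$; $g\in\mathcal H\otimes\mathcal D$ has slope $\le t$ if for some $\rho\in(0,1)$, $\sup_np^{-(t+t_{HT,d})n}\|(1\otimes\varphi)^{-n}g\|_{\rho^{1/p^n}}<\infty$; slope of $g$ = infimum of such $t$; slope of a $\Lambda_{\mathbb Q_p}$-submodule = smallest $t$ bounding the slopes of all its elements. *)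

(* Defs.v *)
From HB Require Import structures.
From mathcomp Require Import all_boot all_order all_algebra.
From mathcomp Require Import all_classical all_reals all_analysis.
Set Implicit Arguments. Unset Strict Implicit. Unset Printing Implicit Defensive.
Import Order.TTheory GRing.Theory Num.Theory.
Import numFieldNormedType.Exports.
Local Open Scope classical_set_scope.
Local Open Scope ring_scope.

Section Padic.
Variables (R : realType) (K : fieldType) (abs : K -> R) (p : nat).

Definition is_Qp : Prop :=
  [/\ prime p,
      forall x, (abs x == 0) = (x == 0),
      forall x y, abs (x * y) = abs x * abs y,
      forall x y, abs (x + y) <= Num.max (abs x) (abs y)
    & forall n : nat, (0 < n)%N -> abs n%:R = (p%:R ^- logn p n : R)] /\
      (forall x : nat -> K,
          (forall e : R, 0 < e -> exists M, forall m n, (M <= m)%N -> (M <= n)%N ->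
               abs (x m - x n) < e) ->
          exists l, forall e : R, 0 < e -> exists M, forall n, (M <= n)%N -> abs (x n - l) < e) /\
  (forall (x : K) (e : R), 0 < e -> exists r : rat, abs (x - ratr r) < e).

Definition topgen_1pZp (u : K) : Prop :=
  abs (u - 1) <= (p%:R)^-1 /\
  forall y, abs (y - 1) <= (p%:R)^-1 ->
    forall e : R, 0 < e -> exists z : int, abs (u ^ z - y) < e.

Definition ordp (x : K) : R := - (ln (abs x) / ln p%:R).

Definition ps_of_poly (q : {poly K}) : nat -> K := fun k => q`_k.
Definition ps_mul (f g : nat -> K) : nat -> K :=
  fun n => \sum_(i < n.+1) f i * g (n - i)%N.

(** ||f||_rho : sup over the closed disc of radius rho; by the maximum
    principle this is the Gauss norm sup_k |a_k| rho^k. *)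
Definition psnorm (r : R) (f : nat -> K) : R :=
  sup (range (fun k => abs (f k) * r ^+ k)).

(** f in H : converges on the open unit disc *)
Definition inH (f : nat -> K) : Prop :=
  forall r : R, 0 < r < 1 -> (fun k => abs (f k) * r ^+ k) @ \oo --> (0 : R).

(** f in Lambda_{Q_p} = Q_p (x) Z_p[[x]] : bounded coefficients *)
Definition inLam (f : nat -> K) : Prop := exists M : R, forall k, abs (f k) <= M.

Definition omega_poly (n : nat) : {poly K} := ('X + 1) ^+ (p ^ n) - 1.
Definition xi_poly (n : nat) : {poly K} :=
  if n is n'.+1 then divp (omega_poly n) (omega_poly n') else p%:R *: 'X.
Definition twist_poly (u : K) (j : int) (f : {poly K}) : {poly K} :=
  f \Po ((u ^ (- j))%:P * ('X + 1) - 1).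

Definition in_oc (lo hi j : int) : bool := (lo < j) && (j <= hi).
Definition in_J (a : int) (len : nat) (j : int) : bool := (a <= j) && (j < a + len%:Z).

Definition ell0 (u : K) (lo hi : int) : {poly K} :=
  \prod_(k < `|hi - lo|%N) ((p%:R)^-1 *: twist_poly u (lo + 1 + k%:Z) (xi_poly 0)).

(** tilde xi_n^{J' c J} with J' = ]lo, hi], J = {a,..,a+len-1}: for n >= 1 the
    unique polynomial of degree < ((p-1)|J'| + |J|) p^(n-1) satisfying the
    congruences (xget picks it; it exists and is unique). *)
Definition tilde_xi_spec (u : K) (n : nat) (lo hi a : int) (len : nat) (q : {poly K}) : Prop :=
  [/\ (size q <= ((p - 1) * `|hi - lo| + len) * p ^ n.-1)%N,
      forall j, in_oc lo hi j -> dvdp (twist_poly u j (omega_poly n)) (q - (p%:R)^-1 *: twist_poly u j (xi_poly n))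
    & forall j, in_J a len j -> ~~ in_oc lo hi j -> dvdp (twist_poly u j (omega_poly n.-1)) (q - 1)].

Definition tilde_xi (u : K) (n : nat) (lo hi a : int) (len : nat) : {poly K} :=
  if n is 0 then ell0 u lo hi else xget 0 (tilde_xi_spec u n lo hi a len).

Variable d : nat. (* dimension of D is d.+1 *)

(** matrix (row-vector convention, standard basis b_k of D = K^(d+1)) of
    T_n, where the rows of Bm are the adapted basis v_i and t the HT weights *)
Definition Tmat (u : K) (Bm : 'M[K]_d.+1) (t : 'I_d.+1 -> int) (a : int) (len : nat)
    (n : nat) : 'M[{poly K}]_d.+1 :=
  map_mx polyC (invmx Bm) *m
  diag_mx (\row_i tilde_xi u n (t i) (t ord_max) a len) *m map_mx polyC Bm.

(** Z_{N+k-1}: Zseq 0 = Id = Z_{N-1}, Z_n = Z_{n-1} o (phi^{n+1} T_n phi^{-(n+1)}) *)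
Fixpoint Zseq (u : K) (Phi Bm : 'M[K]_d.+1) (t : 'I_d.+1 -> int) (a : int) (len N : nat)
    (k : nat) : 'M[{poly K}]_d.+1 :=
  if k is k'.+1 then
    Zseq u Phi Bm t a len N k' *m
      (map_mx polyC (invmx Phi ^+ (N + k').+1) *m Tmat u Bm t a len (N + k')
         *m map_mx polyC (Phi ^+ (N + k').+1))
  else 1%:M.

(** elements of H (x) D : coordinate vectors of power series *)
Definition psnormv (r : R) (g : 'I_d.+1 -> nat -> K) : R :=
  \big[Num.max/0]_(l < d.+1) psnorm r (g l).

Definition phi_inv_pow (Phi : 'M[K]_d.+1) (n : nat) (g : 'I_d.+1 -> nat -> K) :
    'I_d.+1 -> nat -> K :=
  fun k m => \sum_(l < d.+1) g l m * (invmx Phi ^+ n) l k.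

Definition has_slope_le (Phi : 'M[K]_d.+1) (tHTd : int) (g : 'I_d.+1 -> nat -> K) (s : R) : Prop :=
  exists rho : R, 0 < rho < 1 /\ exists M : R, forall n : nat,
    (p%:R `^ (- (s + tHTd%:~R) * n%:R)) *
      psnormv (rho `^ (p%:R `^ (- n%:R))) (phi_inv_pow Phi n g) <= M.

Definition ps_slope (Phi : 'M[K]_d.+1) (tHTd : int) (g : 'I_d.+1 -> nat -> K) : \bar R :=
  ereal_inf [set (s%:E) | s in [set s | has_slope_le Phi tHTd g s]].

Definition Zapply (Z : 'I_d.+1 -> 'I_d.+1 -> nat -> K) (w : 'rV[K]_d.+1) : 'I_d.+1 -> nat -> K :=
  fun l m => \sum_(k < d.+1) w 0 k * Z k l m.

Definition in_Lam_span (Z : 'I_d.+1 -> 'I_d.+1 -> nat -> K) (g : 'I_d.+1 -> nat -> K) : Prop :=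
  exists (n : nat) (w : 'I_n -> 'rV[K]_d.+1) (lam : 'I_n -> nat -> K),
    (forall i, inLam (lam i)) /\
    g = fun l m => \sum_(i < n) ps_mul (lam i) (Zapply Z (w i) l) m.

Definition mat_in_basis (E : 'M[K]_d.+1) (Z : 'I_d.+1 -> 'I_d.+1 -> nat -> K) :
    'I_d.+1 -> 'I_d.+1 -> nat -> K :=
  fun i j m => \sum_(k < d.+1) \sum_(l < d.+1) E i k * Z k l m * invmx E l j.

(** monomials in lambda_{i,j} (i<j) of total degree <= d (= dim D - 1) *)
Definition mono_ok (mo : {ffun 'I_d.+1 * 'I_d.+1 -> 'I_d.+1}) : bool :=
  [forall ij : 'I_d.+1 * 'I_d.+1, (ij.2 <= ij.1)%N ==> (mo ij == ord0)] && (\sum_(ij : 'I_d.+1 * 'I_d.+1) (mo ij : nat) <= d)%N.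

Definition poly_eval (c : {ffun 'I_d.+1 * 'I_d.+1 -> 'I_d.+1} -> nat -> K)
    (P : 'M[K]_d.+1) : nat -> K :=
  fun m => \sum_(mo | mono_ok mo) (\prod_(ij : 'I_d.+1 * 'I_d.+1) P ij.1 ij.2 ^+ mo ij) * c mo m.

Definition first_rows (A : 'M[K]_d.+1) (i : 'I_d.+1) : 'M[K]_d.+1 :=
  \matrix_(k, l) if (k <= i)%N then A k l else 0.

Definition is_filtration (Fil : int -> 'M[K]_d.+1) : Prop :=
  [/\ forall m : int, (Fil (m + 1)%R <= Fil m)%MS,
      exists m : int, (1%:M <= Fil m)%MS
    & exists m : int, \rank (Fil m) = 0%N].

Definition HT_weights (Fil : int -> 'M[K]_d.+1) (t : 'I_d.+1 -> int) : Prop :=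
  (forall i j : 'I_d.+1, (i <= j)%N -> t i <= t j) /\
  forall m : int, (\rank (Fil m) - \rank (Fil (m + 1)%R))%N = #|[set i | t i == m]|.

Definition is_refinement (Phi : 'M[K]_d.+1) (Fil : int -> 'M[K]_d.+1) (t : 'I_d.+1 -> int)
    (F : 'I_d.+1 -> 'M[K]_d.+1) : Prop :=
  [/\ forall i, \rank (F i) = i.+1,
      forall i j : 'I_d.+1, (i <= j)%N -> (F i <= F j)%MS,
      forall i, (F i *m Phi <= F i)%MS,
      forall i, (0 < \rank (F i :&: Fil (t i)))%N
    & forall i, \rank (F i :&: Fil (t i + 1)%R) = 0%N].

End Padic.

(* Main.v *)
Require Import Defs.
From HB Require Import structures.
From mathcomp Require Import all_boot all_order all_algebra.
From mathcomp Require Import all_classical all_reals all_analysis.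
From mathcomp Require Import ring lra zify.
From mathcomp Require Import -(notations) mpoly.
Set Implicit Arguments.
Unset Strict Implicit.
Unset Printing Implicit Defensive.
Import Order.TTheory GRing.Theory Num.Theory.
Import numFieldNormedType.Exports.
Local Open Scope classical_set_scope.
Local Open Scope ring_scope.

(** Write [Y = omega_(n-1)].  The polynomial [tilde xi_n] is [G(Y)] where [G] is a multiple of
    [Psi], the product over [J'] of the twisted [p]-th cyclotomic polynomials, and [G - 1] a multiple
    of the product over [J] of the linear polynomials [pi_j = u^(-j p^(n-1)) (1 + Y) - 1].  So
    [G = 1 + H prod_J pi_j], with [H] minus the inverse of [prod_J pi_j] modulo [Psi].  On the circle
    [|Y| = r], [r^(p-1) = 1/p], the leading terms of [Psi] and [pi_j] dominate, hence
    [|H|_r <= r^(-|J|)].  Since the valuation of [Q_p] is discrete, this yields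
    [|tilde xi_n|_1 <= p^(|J'| + floor((|J|-1)/(p-1)))]; on smaller discs, where [Y] is of size
    [p^(-n)], it yields [tilde xi_n = 1 + O(p^(-n|J|))].

    In the basis of eigenvectors, with [Q] the transpose of [P] and [A = diag(alpha)], the operator
    [Z_k] is the product of the [A^(-n-1) Q^(-1) diag(tilde xi_n) Q A^(n+1)].  These matrices are lower
    triangular and [|alpha_j / alpha_i| < p^|J|] for [j <= i], so the factors are [1 + O(theta^n)] and
    the product converges.  The growth of [Z_oo] is read off by grouping the first factors as
    [A^(-1) Q^(-1) diag(tilde xi_n) Q].

    To get polynomials in the [lambda_(i,j)] all estimates are made for the matrix [Q] with
    indeterminate entries, over multivariate polynomials with the Gauss norm, for which [Q] and
    [Q^(-1)] are integral.  Giving [lambda_(i,j)] the weight [j - i], the [(i,j)] entry of all these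
    matrices is isobaric of weight [i - j], which bounds its degree. *)

(** * Absolute value of Q_p *)

Section AbsoluteValue.
Variables (R : realType) (K : fieldType) (abs : K -> R) (p : nat).
Hypothesis hQp : is_Qp abs p.

Lemma Qp_prime : prime p. Proof. by case: hQp => -[]. Qed.

Lemma Qp_p_gt0 : 0 < (p%:R : R).
Proof. by rewrite ltr0n prime_gt0 // Qp_prime. Qed.

Lemma Qp_p_gt1 : 1 < (p%:R : R).
Proof. by rewrite ltr1n prime_gt1 // Qp_prime. Qed.

Lemma abs_eq0 x : (abs x == 0) = (x == 0).
Proof. by case: hQp => -[]. Qed.

Lemma abs0 : abs 0 = 0.
Proof. by apply/eqP; rewrite abs_eq0. Qed.

Lemma absM x y : abs (x * y) = abs x * abs y.
Proof. by case: hQp => -[]. Qed.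

Lemma absD x y : abs (x + y) <= Num.max (abs x) (abs y).
Proof. by case: hQp => -[]. Qed.

Lemma abs_nat n : (0 < n)%N -> abs n%:R = p%:R ^- logn p n.
Proof. by case: hQp => -[_ _ _ _ h] _; apply: h. Qed.

Lemma abs1 : abs 1 = 1.
Proof. by rewrite -[X in abs X]/(1%:R) abs_nat // logn1 expr0 invr1. Qed.

Lemma abs_p : abs p%:R = p%:R^-1.
Proof.
by rewrite abs_nat ?prime_gt0 ?Qp_prime // lognE Qp_prime prime_gt0 ?Qp_prime //
  dvdnn divnn prime_gt0 ?Qp_prime // logn1.
Qed.

(** Nonnegativity is not among the axioms of [is_Qp], so the value [-1] has to be excluded. It would
    give [|-p| = -1/p], whereas [-p = -1 - (p - 1)] and [|p - 1| = 1] would give [|-p| <= -1]. *)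
Lemma absN1 : abs (-1) = 1.
Proof.
have : abs (-1) ^+ 2 = 1 by rewrite expr2 -absM mulrNN mulr1 abs1.
move/eqP; rewrite sqrf_eq1 => /orP[/eqP // |/eqP h].
have pp := prime_gt1 Qp_prime.
have : abs (- p%:R) <= -1.
  rewrite -{1}(prednK (ltnW pp)) -addn1 natrD opprD.
  apply: le_trans (absD _ _) _; rewrite h ge_max lexx andbT.
  have p1 : (0 < p.-1)%N by rewrite -ltnS (prednK (ltnW pp)).
  rewrite -[- p.-1%:R]mulN1r absM h abs_nat // lognE gtnNdvd ?prednK ?(ltnW pp) //.
  by rewrite !andbF expr0 invr1 mulr1.
by rewrite -mulN1r absM h abs_p mulN1r lerN2 invf_ge1 ?Qp_p_gt0 // leNgt Qp_p_gt1.
Qed.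

Lemma absN x : abs (- x) = abs x.
Proof. by rewrite -mulN1r absM absN1 mul1r. Qed.

Lemma abs_ge0 x : 0 <= abs x.
Proof.
rewrite leNgt; apply/negP => h.
have := absD x (- x); rewrite subrr abs0 absN maxxx leNgt.
by rewrite h.
Qed.

Lemma abs_gt0 x : (0 < abs x) = (x != 0).
Proof. by rewrite lt_def abs_ge0 andbT abs_eq0. Qed.

Lemma absD_le x y B : abs x <= B -> abs y <= B -> abs (x + y) <= B.
Proof. by move=> hx hy; apply: le_trans (absD _ _) _; rewrite ge_max hx hy. Qed.

Lemma absB_le x y B : abs x <= B -> abs y <= B -> abs (x - y) <= B.
Proof. by move=> hx hy; apply: absD_le => //; rewrite absN. Qed.

Lemma absBC x y : abs (x - y) = abs (y - x).
Proof. by rewrite -absN opprB. Qed.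

Lemma abs_sum_le (I : Type) (s : seq I) (P : pred I) (F : I -> K) B :
  0 <= B -> (forall i, P i -> abs (F i) <= B) -> abs (\sum_(i <- s | P i) F i) <= B.
Proof.
move=> B0 h; elim/big_ind: _ => //; first by rewrite abs0.
by move=> x y; apply: absD_le.
Qed.

Lemma absV x : abs x^-1 = (abs x)^-1.
Proof.
have [->|x0] := eqVneq x 0; first by rewrite invr0 abs0 invr0.
apply: (mulfI (_ : abs x != 0)); first by rewrite abs_eq0.
by rewrite -absM !divff ?abs1 // abs_eq0.
Qed.

Lemma absX x n : abs (x ^+ n) = abs x ^+ n.
Proof. by elim: n => [|n IH]; rewrite ?expr0 ?abs1 // !exprS absM IH. Qed.

Lemma abs_nat_le1 n : abs n%:R <= 1.
Proof.
case: n => [|n]; first by rewrite abs0.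
rewrite abs_nat // invf_le1 ?exprn_gt0 ?Qp_p_gt0 //.
by rewrite exprn_ege1 // ltW // Qp_p_gt1.
Qed.

(** Isosceles principle of the ultrametric inequality: it yields exact absolute values from a
    dominant term. *)
Lemma abs_eq_near x y : abs (x - y) < abs y -> abs x = abs y.
Proof.
move=> h; apply/eqP; rewrite eq_le; apply/andP; split.
  by rewrite -[x](subrK y); apply: absD_le => //; apply: ltW.
rewrite leNgt; apply/negP => h2; move: (lexx (abs y)); rewrite leNgt => /negP; apply.
have : abs y <= Num.max (abs x) (abs (x - y)).
  by rewrite -{1}[y](subKr x); apply: le_trans (absD _ _) _; rewrite absN.
by rewrite le_max => /orP[] h3; [apply: le_lt_trans h3 h2 | apply: le_lt_trans h3 h].
Qed.

Lemma abs_nat_dvd n : (p %| n)%N -> abs n%:R <= p%:R^-1.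
Proof.
move=> /dvdnP[k ->]; by rewrite natrM absM abs_p ler_piMl ?abs_nat_le1 // invr_ge0 ltW // Qp_p_gt0.
Qed.

Lemma natr_neq0 n : (0 < n)%N -> (n%:R : K) != 0.
Proof.
move=> n0; rewrite -abs_eq0 abs_nat // invr_eq0 expf_neq0 //.
by rewrite gt_eqF // Qp_p_gt0.
Qed.

(* [K] being the completion of the rationals, its value group is that of the rationals. *)
Lemma abs_value_group x : x != 0 -> exists z : int, abs x = p%:R ^ z.
Proof.
move=> x0; have xgt0 : 0 < abs x by rewrite abs_gt0.
have p0 : (p%:R : R) != 0 by rewrite gt_eqF ?Qp_p_gt0.
have int_val (m : int) : m != 0 -> exists z : int, abs (m%:~R) = p%:R ^ z.
  have nat_val (n : nat) : (0 < n)%N -> exists z : int, abs (n%:R) = p%:R ^ z.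
    by move=> n0; exists (- (logn p n)%:Z); rewrite abs_nat // -exprnN.
  case: m => n; first by rewrite -lt0n => /nat_val.
  by rewrite NegzE mulrNz absN => _; apply: nat_val.
(* A rational closer to [x] than [|x|] has the same absolute value as [x]. *)
case: hQp => _ [_ /(_ x _ xgt0)[r hr]].
have e : abs x = abs (ratr r).
  by symmetry; apply: abs_eq_near; rewrite absBC.
rewrite e /ratr absM absV.
have [z1 ->] : exists z : int, abs (numq r)%:~R = p%:R ^ z.
  apply: int_val; rewrite numq_eq0; apply/negP => /eqP r0.
  by move: xgt0; rewrite e /ratr r0 mul0r abs0 ltxx.
have [z2 ->] := int_val _ (denq_neq0 r).
by exists (z1 - z2); rewrite expfzDr // -invr_expz.
Qed.

End AbsoluteValue.

(** * Gauss norms *)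

(* [gauss_le abs r B f] says that the Gauss norm of [f] on the disc of radius [r] is at most [B]. *)
Definition gauss_le (R : realType) (K : fieldType) (abs : K -> R) (r B : R) (f : {poly K}) : Prop :=
  forall k, abs f`_k * r ^+ k <= B.

Section GaussNorm.
Variables (R : realType) (K : fieldType) (abs : K -> R) (p : nat).
Hypothesis hQp : is_Qp abs p.

Local Notation gauss_le := (gauss_le abs).

Lemma gauss_le_ge0 r B f : gauss_le r B f -> 0 <= B.
Proof. by move=> /(_ 0%N); apply: le_trans; rewrite expr0 mulr1 (abs_ge0 hQp). Qed.

Lemma gauss_leW r B B' f : B <= B' -> gauss_le r B f -> gauss_le r B' f.
Proof. by move=> h hf k; apply: le_trans (hf k) h. Qed.

Lemma gauss_le_radius r r' B f : 0 <= r' -> r' <= r -> gauss_le r B f -> gauss_le r' B f.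
Proof.
move=> r0 radius hf k; apply: le_trans (hf k).
by rewrite ler_wpM2l ?(abs_ge0 hQp) // lerXn2r // nnegrE // (le_trans r0).
Qed.

Lemma gauss_leC r B c : abs c <= B -> gauss_le r B c%:P.
Proof.
move=> h; have B0 := le_trans (abs_ge0 hQp c) h.
case=> [|k]; rewrite coefC /=; first by rewrite expr0 mulr1.
by rewrite (abs0 hQp) mul0r.
Qed.

Lemma gauss_le0 r B : 0 <= B -> gauss_le r B 0.
Proof. by move=> B0; apply: gauss_leC; rewrite (abs0 hQp). Qed.

Lemma gauss_le1 r B : 1 <= B -> gauss_le r B 1.
Proof. by move=> B0; apply: gauss_leC; rewrite (abs1 hQp). Qed.

Lemma gauss_leD r B f g : gauss_le r B f -> gauss_le r B g -> 0 <= r -> gauss_le r B (f + g).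
Proof.
move=> hf hg r0 k; rewrite coefD.
apply: le_trans (ler_wpM2r (exprn_ge0 k r0) (absD hQp _ _)) _.
by rewrite maxr_pMl ?exprn_ge0 // ge_max hf hg.
Qed.

Lemma gauss_leN r B f : gauss_le r B f -> gauss_le r B (- f).
Proof. by move=> hf k; rewrite coefN (absN hQp). Qed.

Lemma gauss_leB r B f g : gauss_le r B f -> gauss_le r B g -> 0 <= r -> gauss_le r B (f - g).
Proof. by move=> hf hg r0; apply: gauss_leD => //; apply: gauss_leN. Qed.

Lemma gauss_le_sum (I : Type) (s : seq I) (P : pred I) (F : I -> {poly K}) r B :
  0 <= B -> 0 <= r -> (forall i, P i -> gauss_le r B (F i)) -> gauss_le r B (\sum_(i <- s | P i) F i).
Proof.
move=> B0 r0 h; elim/big_ind: _ => //; first exact: gauss_le0.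
by move=> f g hf hg; apply: gauss_leD.
Qed.

Lemma gauss_leM r B C f g : 0 <= r -> gauss_le r B f -> gauss_le r C g -> gauss_le r (B * C) (f * g).
Proof.
move=> r0 hf hg k; rewrite coefM.
have B0 := gauss_le_ge0 hf; have C0 := gauss_le_ge0 hg.
(* The general argument divides by [r ^+ k]; at radius [0] only the constant coefficients count. *)
have [rz|rn] := eqVneq r 0.
  rewrite rz; case: k => [|k]; last by rewrite expr0n mulr0 mulr_ge0.
  rewrite expr0 mulr1 big_ord_recl big_ord0 addr0 (absM hQp).
  have := hf 0%N; have := hg 0%N; rewrite !expr0 !mulr1 => h1 h2.
  by rewrite ler_pM // (abs_ge0 hQp).
have rk : 0 < r ^+ k by rewrite exprn_gt0 // lt_def rn.
rewrite -ler_pdivlMr //; apply: (abs_sum_le hQp).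
  by rewrite divr_ge0 ?mulr_ge0 // ltW.
move=> i _; rewrite ler_pdivlMr // (absM hQp).
have -> : r ^+ k = r ^+ i * r ^+ (k - i) by rewrite -exprD subnKC // -ltnS.
by rewrite mulrACA ler_pM // mulr_ge0 ?exprn_ge0 // (abs_ge0 hQp).
Qed.

Lemma gauss_leZ r B C c f : 0 <= r -> abs c <= B -> gauss_le r C f -> gauss_le r (B * C) (c *: f).
Proof. by move=> r0 hc hf; rewrite -mul_polyC; apply: gauss_leM => //; apply: gauss_leC. Qed.

Lemma gauss_leX r B n f : 0 <= r -> gauss_le r B f -> gauss_le r (B ^+ n) (f ^+ n).
Proof.
move=> r0 hf; elim: n => [|n IH]; first by rewrite !expr0; apply: gauss_le1.
by rewrite !exprS; apply: gauss_leM.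
Qed.

Lemma gauss_le_polyX r : 0 <= r -> gauss_le r r 'X.
Proof.
move=> r0 k; rewrite coefX; case: eqP => [->|_].
  by rewrite expr1 (abs1 hQp) mul1r.
by rewrite (abs0 hQp) mul0r.
Qed.

Lemma gauss_le_prod n (F : 'I_n -> {poly K}) r B :
  0 <= r -> (forall i, gauss_le r B (F i)) -> gauss_le r (B ^+ n) (\prod_(i < n) F i).
Proof.
move=> r0 h; elim: n F h => [|n IH] F h; first by rewrite big_ord0 expr0; apply: gauss_le1.
by rewrite big_ord_recl exprS; apply: gauss_leM => //; apply: IH => i.
Qed.

(** On the smaller disc each term [f_i g^i] is bounded by [|f_i| r^i], since [g] maps the disc of
    radius [r'] into the disc of radius [r]. *)
Lemma gauss_le_comp r r' B f g : 0 <= r' -> gauss_le r B f -> gauss_le r' r g -> gauss_le r' B (f \Po g).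
Proof.
move=> r0 hf hg; rewrite comp_polyE; apply: gauss_le_sum => //; first exact: gauss_le_ge0 hf.
move=> i _; apply: gauss_leW (hf i) _.
by apply: gauss_leZ => //; apply: gauss_leX.
Qed.

(* Euclidean division does not increase the Gauss norm when the leading term of the divisor
   realises its norm. *)
Lemma gauss_le_division r B f g : 0 < r -> g != 0 ->
  gauss_le r (abs (lead_coef g) * r ^+ (size g).-1) g -> gauss_le r B f ->
  exists q s, [/\ f = q * g + s, (size s < size g)%N, gauss_le r B s
                & gauss_le r (B / (abs (lead_coef g) * r ^+ (size g).-1)) q].
Proof.
move=> r0 g0; set G := abs _ * _ => hg.
have lg0 : 0 < abs (lead_coef g) by rewrite (abs_gt0 hQp) lead_coef_eq0.
have G0 : 0 < G by rewrite mulr_gt0 // exprn_gt0.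
have [n] := ubnP (size f); elim: n f => // n IH f ltfn hf.
have B0 := gauss_le_ge0 hf; have BG0 : 0 <= B / G by rewrite divr_ge0 // ltW.
case: (ltnP (size f) (size g)) => hfg.
  by exists 0, f; split => //; [rewrite mul0r add0r | apply: gauss_le0].
have sg : (0 < size g)%N by rewrite size_poly_gt0.
have f0 : f != 0 by rewrite -size_poly_gt0 (leq_trans sg).
(* [t * g] has the leading term of [f]. As the leading term of [g] has norm [G], [t] is bounded by
   [B / G], and subtracting [t * g] preserves the bound [B]. *)
pose c := lead_coef f / lead_coef g; pose t := c *: 'X^(size f - size g).
have ht : gauss_le r (B / G) t.
  move=> k; rewrite coefZ coefXn; case: eqP => [->|_]; last first.
    by rewrite mulr0 (abs0 hQp) mul0r.
  rewrite mulr1 (absM hQp) (absV hQp) ler_pdivlMr // /G.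
  rewrite mulrACA divfK ?gt_eqF // -exprD.
  have -> : (size f - size g + (size g).-1 = (size f).-1)%N.
    by move: hfg sg; lia.
  exact: hf.
have tg0 : c != 0 by rewrite mulf_neq0 ?invr_eq0 ?lead_coef_eq0.
have stg : size (t * g) = size f.
  rewrite /t -scalerAl size_scale // size_monicM ?monicXn // size_polyXn.
  by rewrite addSn /= subnK.
have [||q [s [e1 e2 e3 e4]]] := IH (f - t * g).
- rewrite (@leq_trans (size f)) // (@leq_ltn_trans (size f).-1) //; last first.
    by rewrite prednK // size_poly_gt0.
  apply/leq_sizeP => j hj; rewrite coefB.
  have sf : (0 < size f)%N by rewrite size_poly_gt0.
  move: hj; rewrite leq_eqVlt => /orP[/eqP <-|hj]; last first.
    by rewrite !nth_default ?subrr // ?stg -(prednK sf).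
  have -> : (t * g)`_(size f).-1 = lead_coef (t * g) by rewrite /lead_coef stg.
  rewrite lead_coefM lead_coefZ lead_coefXn mulr1 /c divfK ?lead_coef_eq0 //.
  by rewrite /lead_coef subrr.
- apply: gauss_leB => //; last exact: ltW.
  by rewrite -[B](@divfK _ G) ?gt_eqF //; apply: gauss_leM => //; apply: ltW.
exists (q + t), s; split => //; last by apply: gauss_leD => //; apply: ltW.
by rewrite mulrDl addrAC -e1 subrK.
Qed.

End GaussNorm.

(** * The interpolation problem *)

(* [Phi1 p] is the [p]-th cyclotomic polynomial in the variable [1 + X], and [lin V] is [V (1 + X) - 1]. *)
Definition Phi1 (K : fieldType) (p : nat) : {poly K} := \sum_(i < p) ('X + 1) ^+ i.
Definition lin (K : fieldType) (V : K) : {poly K} := V%:P * ('X + 1) - 1.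

Section Interpolation.
Variables (R : realType) (K : fieldType) (abs : K -> R) (p : nat).
Hypotheses (hQp : is_Qp abs p) (hodd : odd p).

Local Notation gauss_le := (gauss_le abs).
Local Notation Phi := (Phi1 K p).


Lemma p_gt2 : (2 < p)%N.
Proof. exact: odd_prime_gt2 hodd (Qp_prime hQp). Qed.

Lemma mulX_Phi1 : 'X * Phi = ('X + 1) ^+ p - 1.
Proof. by rewrite subrX1 addrK /Phi1. Qed.

Lemma coef_Phi1 j : Phi`_j = 'C(p, j.+1)%:R.
Proof.
have -> : Phi`_j = ('X * Phi)`_j.+1 by rewrite coefXM.
rewrite mulX_Phi1 coefB coef1 subr0 exprD1n coef_sum.
have [jp|jp] := ltnP j.+1 p.+1.
  rewrite (bigD1 (Ordinal jp)) //= big1 ?addr0 ?coefMn ?coefXn ?eqxx // => i ij.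
  rewrite coefMn coefXn; case: eqP => [e|_]; last by rewrite mul0rn.
  by case/eqP: ij; apply: val_inj.
rewrite bin_small // big1 // => i _; rewrite coefMn coefXn.
by case: eqP (ltn_ord i) jp => [<-|_ _ _]; rewrite ?mul0rn // => h1; rewrite leqNgt h1.
Qed.

Lemma size_Phi1 : size Phi = p.
Proof.
have p0 := prime_gt0 (Qp_prime hQp).
apply/eqP; rewrite eqn_leq; apply/andP; split.
  by apply/leq_sizeP => j hj; rewrite coef_Phi1 bin_small.
rewrite leqNgt; apply/negP => h.
have : Phi`_p.-1 = 0 by rewrite nth_default // -ltnS prednK.
by rewrite coef_Phi1 prednK // binn => /eqP; rewrite oner_eq0.
Qed.

Lemma lead_coef_Phi1 : lead_coef Phi = 1.
Proof. by rewrite /lead_coef size_Phi1 coef_Phi1 prednK ?binn ?prime_gt0 ?(Qp_prime hQp). Qed.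

Lemma linE (V : K) : lin V = V *: 'X + (V - 1)%:P.
Proof. by rewrite /lin mulrDr mulr1 mul_polyC polyCB -addrA. Qed.

Lemma abs_one_unit (V : K) : abs (V - 1) <= p%:R^-1 -> abs V = 1.
Proof.
move=> h; rewrite -(abs1 hQp); apply: (abs_eq_near hQp); rewrite (abs1 hQp).
by apply: le_lt_trans h _; rewrite invf_lt1 ?(Qp_p_gt0 hQp) // (Qp_p_gt1 hQp).
Qed.

Lemma lin_lead (V : K) : V != 0 -> size (lin V) = 2%N /\ lead_coef (lin V) = V.
Proof.
move=> V0; rewrite linE; have s2 : size (V *: 'X + (V - 1)%:P) = 2%N.
  by rewrite size_polyDl size_scale ?size_polyX // size_polyC; case: (_ == 0).
by split => //; rewrite /lead_coef s2 coefD coefZ coefX coefC /= mulr1 addr0.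
Qed.

Definition PhiV (V : K) : {poly K} := Phi \Po lin V.

Lemma abs_unit_neq0 (V : K) : abs (V - 1) <= p%:R^-1 -> V != 0.
Proof. by move/abs_one_unit => h; rewrite -(abs_eq0 hQp) h oner_eq0. Qed.

Lemma size_PhiV (V : K) : abs (V - 1) <= p%:R^-1 -> size (PhiV V) = p.
Proof. by move/abs_unit_neq0/lin_lead => [h _]; rewrite size_comp_poly2 // size_Phi1. Qed.

Lemma lead_PhiV (V : K) : abs (V - 1) <= p%:R^-1 -> abs (lead_coef (PhiV V)) = 1.
Proof.
move=> h; have [h1 h2] := lin_lead (abs_unit_neq0 h).
rewrite lead_coef_comp ?h1 // lead_coef_Phi1 mul1r h2 (absX hQp).
by rewrite (abs_one_unit h) expr1n.
Qed.

(** The constant term [p] dominates: the intermediate coefficients are divisible by [p] and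
    multiplied by powers of [z], and [|z^(p-1)| <= p^-2] because [p - 1 >= 2]. *)
Lemma abs_Phi1 z : abs z <= p%:R^-1 -> abs Phi.[z] = p%:R^-1.
Proof.
move=> hz; rewrite -(abs_p hQp); apply: (abs_eq_near hQp); rewrite (abs_p hQp).
have p1 := Qp_p_gt1 hQp; have p0 := Qp_p_gt0 hQp; have p2 := p_gt2.
have pV1 : (p%:R^-1 : R) <= 1 by rewrite invf_le1 // ltW.
have pV0 : 0 <= (p%:R^-1 : R) by rewrite invr_ge0 ltW.
apply: (@le_lt_trans _ _ (p%:R^-1 * p%:R^-1)); last first.
  by rewrite gtr_pMr ?invr_gt0 // invf_lt1.
have pp := prednK (prime_gt0 (Qp_prime hQp)).
rewrite (@horner_coef_wide _ p.-1.+1); last by rewrite size_Phi1 pp.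
rewrite big_ord_recl coef_Phi1 bin1 expr0 mulr1 addrAC subrr add0r.
apply: (abs_sum_le hQp); first exact: mulr_ge0.
move=> i _; rewrite coef_Phi1 (absM hQp) (absX hQp) lift0.
have [ip|ip] := eqVneq i.+2 p.
  apply: (@le_trans _ _ (abs z ^+ i.+1)).
    by rewrite ler_piMl ?(abs_nat_le1 hQp) // exprn_ge0 // (abs_ge0 hQp).
  have -> : i.+1 = (i.-1).+2 by move: ip p2; lia.
  rewrite 2!exprS mulrA; apply: (@le_trans _ _ (abs z * abs z)).
    rewrite ler_piMr ?mulr_ge0 ?(abs_ge0 hQp) // exprn_ile1 ?(abs_ge0 hQp) //.
    exact: le_trans hz pV1.
  by rewrite ler_pM // (abs_ge0 hQp).
have ip' : (i.+2 < p)%N by move: (ltn_ord i) ip; lia.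
apply: ler_pM; rewrite ?exprn_ge0 ?(abs_ge0 hQp) //.
  by apply: (abs_nat_dvd hQp); apply: prime_dvd_bin => //; apply: Qp_prime hQp.
rewrite exprS; apply: (le_trans _ hz); rewrite ler_piMr ?(abs_ge0 hQp) //.
by rewrite exprn_ile1 ?(abs_ge0 hQp) // (le_trans hz).
Qed.

Variable r : R.
Hypotheses (r0 : 0 < r) (hr : r ^+ p.-1 = p%:R^-1).

Lemma r_le1 : r <= 1.
Proof.
rewrite leNgt; apply/negP => h; have := exprn_ege1 p.-1 (ltW h).
by rewrite hr leNgt invf_lt1 ?(Qp_p_gt0 hQp) // (Qp_p_gt1 hQp).
Qed.

Lemma pV_le_r : p%:R^-1 <= r.
Proof.
rewrite -hr; have -> : p.-1 = p.-2.+1 by move: p_gt2; lia.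
by rewrite exprS ler_piMr ?exprn_ile1 ?r_le1 // ltW.
Qed.

(** This explains the choice of [r], the common size of the roots [zeta - 1]: the constant term [p]
    and the leading term both have norm exactly [1/p]. *)
Lemma gauss_le_Phi1 : gauss_le r p%:R^-1 Phi.
Proof.
have pV0 : 0 <= (p%:R^-1 : R) by rewrite invr_ge0 ltW // (Qp_p_gt0 hQp).
move=> k; rewrite coef_Phi1; case: (ltngtP k.+1 p) => kp.
- apply: (@le_trans _ _ (abs 'C(p, k.+1)%:R)).
    by rewrite ler_piMr ?(abs_ge0 hQp) // exprn_ile1 ?r_le1 // ltW.
  by apply: (abs_nat_dvd hQp); apply: prime_dvd_bin => //; apply: Qp_prime hQp.
- by rewrite bin_small // (abs0 hQp) mul0r.
- by rewrite -kp binn (abs1 hQp) mul1r -[k]/(k.+1.-1) kp hr.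
Qed.

Lemma gauss_le_lin (V : K) rho : 0 <= rho -> abs V <= 1 -> abs (V - 1) <= rho -> gauss_le rho rho (lin V).
Proof.
move=> h0 hV1 hV; rewrite linE; apply: (gauss_leD hQp) => //; last by apply: (gauss_leC hQp).
by rewrite -{2}[rho]mul1r; apply: (gauss_leZ hQp) => //; apply: (gauss_le_polyX hQp).
Qed.

Lemma gauss_le_lin_r (V : K) : abs (V - 1) <= p%:R^-1 -> gauss_le r r (lin V).
Proof.
move=> hV; apply: gauss_le_lin; first exact: ltW; first by rewrite (abs_one_unit hV).
exact: le_trans hV pV_le_r.
Qed.

Lemma gauss_le_PhiV (V : K) : abs (V - 1) <= p%:R^-1 -> gauss_le r p%:R^-1 (PhiV V).
Proof.
by move=> hV; apply: (gauss_le_comp hQp (ltW r0) gauss_le_Phi1); apply: gauss_le_lin_r.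
Qed.

Variables (V U : nat -> K) (s : nat).
Hypotheses (hV : forall k, abs (V k - 1) <= p%:R^-1) (hU : forall k, abs (U k - 1) <= p%:R^-1).

Definition Psi : {poly K} := \prod_(k < s) PhiV (V k).

Lemma lead_Psi : abs (lead_coef Psi) = 1.
Proof.
rewrite lead_coef_prod; elim/big_ind: _ => [|x y hx hy|i _]; first exact: (abs1 hQp).
  by rewrite (absM hQp) hx hy mulr1.
exact: lead_PhiV.
Qed.

Lemma Psi_neq0 : Psi != 0.
Proof. by rewrite -lead_coef_eq0 -(abs_eq0 hQp) lead_Psi oner_eq0. Qed.

Lemma size_Psi : size Psi = (p.-1 * s).+1.
Proof.
have p0 := prime_gt0 (Qp_prime hQp).
have nz k : PhiV (V k) != 0 by rewrite -size_poly_gt0 size_PhiV.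
rewrite size_prod //; under eq_bigr do rewrite size_PhiV //.
rewrite sum_nat_const card_ord; move: p0; case: (p) => // q _ /=; nia.
Qed.

Lemma gauss_le_Psi : gauss_le r (p%:R^-1 ^+ s) Psi.
Proof. by apply: (gauss_le_prod hQp) => [|i]; [apply: ltW | apply: gauss_le_PhiV]. Qed.

(** The leading term attains the bound of [gauss_le_Psi], so division by [Psi] preserves bounds on
    the circle [r]. *)
Lemma Psi_norm : abs (lead_coef Psi) * r ^+ (size Psi).-1 = p%:R^-1 ^+ s.
Proof. by rewrite lead_Psi mul1r size_Psi /= exprM hr. Qed.

(** At the root [1/W - 1] of [lin W], the polynomial [lin V] takes the value [V/W - 1], of size at
    most [1/p], so [abs_Phi1] applies to each of the [s] factors. *)
Lemma Psi_at_root (W : K) : abs (W - 1) <= p%:R^-1 -> abs Psi.[W^-1 - 1] = p%:R^-1 ^+ s.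
Proof.
move=> hW; rewrite horner_prod (big_morph _ (absM hQp) (abs1 hQp)).
rewrite -[X in _ = _ ^+ X]card_ord -prodr_const; apply: eq_bigr => i _.
rewrite horner_comp abs_Phi1 // /lin !hornerE subrK.
have -> : V i / W - 1 = (V i - 1 - (W - 1)) / W.
  by rewrite opprB addrA subrK mulrBl divff // abs_unit_neq0.
rewrite (absM hQp) (absV hQp) (abs_one_unit hW) invr1 mulr1.
exact: absB_le hQp _ _ _ (hV _) hW.
Qed.

(** Divide [Psi] by [lin W]. The remainder is the constant [Psi(1/W - 1)], exactly as large as the
    norm of [Psi], so normalising the quotient by it leaves only the factor [r^-1]. *)
Lemma lin_inverse (W : K) : abs (W - 1) <= p%:R^-1 ->
  exists2 T, gauss_le r r^-1 T & Psi %| T * lin W - 1.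
Proof.
move=> hW; have [s2 lc] := lin_lead (abs_unit_neq0 hW).
have lW0 : lin W != 0 by rewrite -size_poly_gt0 s2.
have nW : abs (lead_coef (lin W)) * r ^+ (size (lin W)).-1 = r.
  by rewrite lc s2 expr1 (abs_one_unit hW) mul1r.
have [|q [c [e sc _ bq]]] := gauss_le_division hQp r0 lW0 _ gauss_le_Psi.
  by rewrite nW; apply: gauss_le_lin_r.
have rW : (lin W).[W^-1 - 1] = 0.
  by rewrite /lin !hornerE subrK divff ?subrr // abs_unit_neq0.
move: sc; rewrite s2 ltnS => /size1_polyC ec.
have ac : abs c`_0 = p%:R^-1 ^+ s.
  by rewrite -(Psi_at_root hW) e hornerD hornerM rW mulr0 add0r [in RHS]ec hornerC.
have p0 : (p%:R^-1 ^+ s : R) != 0.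
  by rewrite expf_neq0 // invr_eq0 gt_eqF // (Qp_p_gt0 hQp).
have c0 : c`_0 != 0 by rewrite -(abs_eq0 hQp) ac.
exists ((- (c`_0)^-1) *: q).
  move: bq; rewrite nW => bq.
  rewrite -[r^-1](mulKf p0); apply: (gauss_leZ hQp) => //; first exact: ltW.
  by rewrite (absN hQp) (absV hQp) ac.
have -> : (- (c`_0)^-1) *: q * lin W - 1 = (- (c`_0)^-1) *: Psi.
  have e2 : (- (c`_0)^-1) *: c = - 1.
    by rewrite {2}ec -mul_polyC -polyCM mulNr mulVf // polyCN.
  by rewrite e scalerDr e2 scalerAl.
by rewrite dvdpZr // oppr_eq0 invr_eq0.
Qed.

Lemma reduce_Psi B f : gauss_le r B f ->
  exists H : {poly K}, [/\ (size H <= p.-1 * s)%N, gauss_le r B H & Psi %| f - H].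
Proof.
move=> hf; have [|q [H [e sH bH _]]] := gauss_le_division hQp r0 Psi_neq0 _ hf.
  by rewrite Psi_norm; apply: gauss_le_Psi.
exists H; split => //; first by rewrite -ltnS -size_Psi.
by rewrite e addrK dvdp_mull.
Qed.

(* [H] is minus the inverse of the product of the [lin (U l)] modulo [Psi]: this is the solution of the
   interpolation problem, and since the value to interpolate does not depend on the factor of [Psi],
   no denominator arises from the fact that these factors are close to each other. *)
Lemma interpolation L : exists H : {poly K},
  [/\ (size H <= p.-1 * s)%N, gauss_le r (r^-1 ^+ L) H
    & Psi %| 1 + H * \prod_(l < L) lin (U l)].
Proof.
elim: L => [|L [H [h1 h2 h3]]].
  have [|H [h1 h2 h3]] := @reduce_Psi 1 (-1).
    by apply: (gauss_leN hQp); apply: (gauss_le1 hQp).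
  exists H; split; rewrite ?expr0 // big_ord0 mulr1.
  by rewrite -dvdpNr opprD.
have [T hT dT] := lin_inverse (hU L).
have [|H' [k1 k2 k3]] := @reduce_Psi (r^-1 ^+ L.+1) (H * T).
  by rewrite exprSr; apply: (gauss_leM hQp) => //; apply: ltW.
exists H'; split => //; rewrite big_ord_recr /=; set P := \prod_(i < L) _ in h3 *.
(* Modulo [Psi] everything on the right vanishes: by induction, by the choice of [T], and by the
   reduction of [H * T] to [H']. *)
have -> : 1 + H' * (P * lin (U L)) =
  1 + H * P + H * P * (T * lin (U L) - 1) - (H * T - H') * (P * lin (U L)) by ring.
by apply: dvdp_sub; [apply: dvdp_add => //; apply: dvdp_mull | apply: dvdp_mulr].
Qed.

(* The values of [abs] being integral powers of [p], the bound on the circle [r] rounds down on the unit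
   circle; this is the source of the floor in the slope. *)
Lemma gauss_le_unit_disc L (H : {poly K}) : (0 < L)%N -> (size H <= p.-1 * s)%N -> gauss_le r (r^-1 ^+ L) H ->
  gauss_le 1 (p%:R ^+ (s + L.-1 %/ p.-1)) H.
Proof.
move=> L0 sH hH k; rewrite expr1n mulr1.
have p1 := Qp_p_gt1 hQp; have p0 := Qp_p_gt0 hQp; have p2 := p_gt2.
have [->|hk0] := eqVneq H`_k 0; first by rewrite (abs0 hQp) exprn_ge0 // ltW.
have ks : (k < p.-1 * s)%N.
  by apply: leq_trans sH; rewrite ltnNge; apply: contra hk0 => h; rewrite nth_default.
have [z hz] := abs_value_group hQp hk0.
have : abs H`_k <= r^-1 ^+ (L + k).
  by rewrite exprD -ler_pdivrMr ?exprn_gt0 ?invr_gt0 // -exprVn invrK; apply: hH.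
(* The power [p - 1] turns this into a comparison of integral powers of [p], namely
   [z (p-1) <= L + k]. As [k <= (p-1) s - 1], it rounds down to [z <= s + floor((L-1)/(p-1))]. *)
move=> hk; have : abs H`_k ^+ p.-1 <= (r^-1 ^+ (L + k)) ^+ p.-1.
  by rewrite lerXn2r // nnegrE ?(abs_ge0 hQp) // exprn_ge0 // invr_ge0 ltW.
rewrite exprAC exprVn hr invrK hz -[_ ^+ p.-1]/((p%:R ^ z) ^ (p.-1)%:Z) exprz_exp.
rewrite -[_ ^+ (L + k)]/(_ ^ (L + k)%:Z) ler_eXz2l // => hzk.
rewrite -[_ ^+ (s + _)]/(_ ^ (s + _)%:Z) ler_eXz2l //.
have := divn_eq L.-1 p.-1; have : (L.-1 %% p.-1 < p.-1)%N by rewrite ltn_mod; lia.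
set b := (_ %/ _)%N; set m := (_ %% _)%N => mp eL.
rewrite leNgt; apply/negP => hzb; have : (s + b)%:Z + 1 <= z by lia.
move=> {}hzb; have : ((s + b)%:Z + 1) * (p.-1)%:Z <= (L + k)%:Z.
  by apply: le_trans hzk; rewrite ler_wpM2r.
move: eL mp ks p2 L0; clear; move: (p.-1) (p) => q p'; nia.
Qed.

End Interpolation.

(** * The polynomials tilde xi_n *)

Section Coprime.
Variable F : fieldType.

Lemma coprimep_comp (f g h : {poly F}) : coprimep f g -> coprimep (f \Po h) (g \Po h).
Proof.
move/Bezout_eq1_coprimepP => [[a b] /= e]; apply/Bezout_eq1_coprimepP.
by exists (a \Po h, b \Po h); rewrite /= -!comp_polyM -comp_polyD e comp_polyC.
Qed.

Lemma coprimep_prod_l n (f : nat -> {poly F}) g :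
  (forall i, (i < n)%N -> coprimep (f i) g) -> coprimep (\prod_(i < n) f i) g.
Proof.
move=> h; elim/big_ind: _ => [|x y hx hy|i _]; first exact: coprime1p.
  by rewrite coprimepMl hx.
exact: h.
Qed.

Lemma dvdp_prod_coprime n (f : nat -> {poly F}) g :
  (forall i, (i < n)%N -> f i %| g) ->
  (forall i j, (i < j < n)%N -> coprimep (f i) (f j)) -> \prod_(i < n) f i %| g.
Proof.
elim: n => [|n IH] h1 h2; first by rewrite big_ord0 dvd1p.
rewrite big_ord_recr /= Gauss_dvdp; last first.
  by apply: coprimep_prod_l => i hi; apply: h2; rewrite hi /=.
rewrite h1 // andbT; apply: IH => [i hi|i j /andP[ij jn]]; first by apply: h1; apply: ltnW.
by apply: h2; rewrite ij ltnW.
Qed.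

End Coprime.

Section Interpolants.
Variables (R : realType) (K : fieldType) (abs : K -> R) (p : nat).
Hypotheses (hQp : is_Qp abs p) (hodd : odd p).
Variable u : K.
Hypothesis hu : topgen_1pZp abs p u.

Local Notation gauss_le := (gauss_le abs).
Local Notation Phi := (Phi1 K p).
Local Notation om := (omega_poly K p).
Local Notation PhiV := (@PhiV K p).

Lemma abs_u1 : abs (u - 1) <= p%:R^-1.
Proof. by case: hu. Qed.

Lemma abs_u : abs u = 1.
Proof. exact: (abs_one_unit hQp abs_u1). Qed.

Lemma u_neq0 : u != 0.
Proof. exact: (abs_unit_neq0 hQp abs_u1). Qed.

(** Powers of [u] approximate [1 + p], so [u ^+ k = 1] would force [(1 + p)^k = 1], although
    [(1 + p)^k - 1] is a positive integer. *)
Lemma u_not_root_of_unity k : (0 < k)%N -> u ^+ k != 1.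
Proof.
move=> k0; apply/negP => /eqP uk.
have p1 := Qp_p_gt1 hQp; have p0 := Qp_p_gt0 hQp.
pose y : K := (1 + p)%:R.
have y1 : abs (y - 1) <= p%:R^-1 by rewrite /y natrD addrC addKr (abs_p hQp).
have ay := abs_one_unit hQp y1.
have yk : y ^+ k = 1.
  apply/eqP; rewrite -subr_eq0 -(abs_eq0 hQp) eq_le (abs_ge0 hQp) andbT.
  rewrite leNgt; apply/negP => e0.
  (* The precision demanded is [|y^k - 1|] itself, which is at most [|u^z - y|] because
     [(u^z)^k = 1]. *)
  have [z hz] := hu.2 _ y1 _ e0.
  have uz : (u ^ z) ^+ k = 1.
    by rewrite -[_ ^+ k]/((u ^ z) ^ k%:Z) exprzAC -[u ^ k%:Z]/(u ^+ k) uk exp1rz.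
  have auz : abs (u ^ z) = 1.
    apply/eqP; rewrite -(@pexpr_eq1 _ _ k) // ?(abs_ge0 hQp) //.
    by rewrite -(absX hQp) uz (abs1 hQp).
  suff h : abs (y ^+ k - 1) <= abs (u ^ z - y) by move: (le_lt_trans h hz); rewrite ltxx.
  rewrite -{1}uz subrXX (absM hQp) (absBC hQp) ler_piMr ?(abs_ge0 hQp) //.
  apply: (abs_sum_le hQp) => // i _.
  by rewrite (absM hQp) !(absX hQp) ay auz !expr1n mulr1.
have : (((1 + p) ^ k - 1)%N%:R : K) = 0.
  by rewrite natrB ?expn_gt0 // natrX -/y yk subrr.
apply/eqP; apply: (natr_neq0 hQp); rewrite subn_gt0.
by rewrite -{1}(exp1n k) ltn_exp2r // add1n ltnS (prime_gt0 (Qp_prime hQp)).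
Qed.

Lemma uz_neq1 (z : int) : z != 0 -> u ^ z != 1.
Proof.
case: z => k; first by rewrite -lt0n => k0; apply: u_not_root_of_unity.
by move=> _; rewrite NegzE -invr_expz invr_eq1; apply: u_not_root_of_unity.
Qed.

Lemma pVX_le n : (p%:R^-1 : R) ^+ n.+1 <= p%:R^-1.
Proof.
have p1 := Qp_p_gt1 hQp; have p0 := Qp_p_gt0 hQp.
have pV1 : (p%:R^-1 : R) <= 1 by rewrite invf_le1 // ltW.
have pV0 : 0 <= (p%:R^-1 : R) by rewrite invr_ge0 ltW.
by rewrite exprS ler_piMr // exprn_ile1.
Qed.

(** Write [V^p - 1 = (V - 1) Phi(V - 1)]; the second factor has size exactly [1/p]. *)
Lemma abs_exp_p (V : K) m : abs (V - 1) <= p%:R^-1 ^+ m.+1 -> abs (V ^+ p - 1) <= p%:R^-1 ^+ m.+2.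
Proof.
move=> hV.
have e : V ^+ p - 1 = (V - 1) * Phi.[V - 1].
  have := congr1 (fun f => f.[V - 1]) (mulX_Phi1 K p).
  by rewrite !(hornerE, horner_exp) subrK => <-.
rewrite e (absM hQp) (abs_Phi1 hQp hodd); last exact: le_trans hV (pVX_le m).
by rewrite [leRHS]exprSr ler_pM2r // invr_gt0 (Qp_p_gt0 hQp).
Qed.

Lemma abs_exp_pn (V : K) m : abs (V - 1) <= p%:R^-1 -> abs (V ^+ (p ^ m) - 1) <= p%:R^-1 ^+ m.+1.
Proof.
move=> hV; elim: m => [|m IH]; first by rewrite expn0 expr1.
by rewrite expnSr exprM; apply: abs_exp_p.
Qed.

Lemma abs_uz (z : int) : abs (u ^ z - 1) <= p%:R^-1.
Proof.
have nat_case k : abs (u ^+ k - 1) <= p%:R^-1.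
  rewrite subrX1 (absM hQp); apply: (le_trans _ abs_u1).
  rewrite ler_piMr ?(abs_ge0 hQp) //; apply: (abs_sum_le hQp) => // i _.
  by rewrite (absX hQp) abs_u expr1n.
case: z => k; first exact: nat_case.
rewrite NegzE -invr_expz -[u ^ _]/(u ^+ k.+1).
have uk0 : u ^+ k.+1 != 0 by rewrite expf_neq0 // u_neq0.
have -> : (u ^+ k.+1)^-1 - 1 = - (u ^+ k.+1 - 1) / u ^+ k.+1.
  by rewrite opprB mulrBl mul1r divff.
by rewrite (absM hQp) (absN hQp) (absV hQp) (absX hQp) abs_u expr1n invr1 mulr1.
Qed.

(** The twist by [j] multiplies [1 + omega_n = (1 + X)^(p^n)] by this constant. *)
Definition twist_pow n (j : int) : K := (u ^ (- j)) ^+ (p ^ n).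

Lemma abs_twist_pow n j : abs (twist_pow n j - 1) <= p%:R^-1 ^+ n.+1.
Proof. exact: abs_exp_pn (abs_uz _). Qed.

Lemma abs_twist_pow1 n j : abs (twist_pow n j - 1) <= p%:R^-1.
Proof. exact: le_trans (abs_twist_pow n j) (pVX_le n). Qed.

Lemma twist_pow_inj n i j : i != j -> twist_pow n i != twist_pow n j.
Proof.
move=> ij; have z0 : (j - i) * (p ^ n)%:Z != 0.
  have pn : (0 < p ^ n)%N by rewrite expn_gt0 (prime_gt0 (Qp_prime hQp)).
  by rewrite mulf_neq0 // ?subr_eq0 1?eq_sym //; move: pn; lia.
apply: contra (uz_neq1 z0) => /eqP e.
have Vz k : twist_pow n k = u ^ (- k * (p ^ n)%:Z).
  by rewrite /twist_pow -[_ ^+ _]/(_ ^ (p ^ n)%:Z) exprz_exp.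
rewrite mulrBl expfzDr ?u_neq0 // -[X in _ * X]/(u ^ (- (i * _))) -!mulNr -Vz e Vz.
by rewrite -expfzDr ?u_neq0 // mulNr subrr expr0z.
Qed.

Lemma omD1 n : om n + 1 = ('X + 1) ^+ (p ^ n).
Proof. by rewrite /omega_poly subrK. Qed.

Lemma om0 : om 0 = 'X.
Proof. by rewrite /omega_poly expn0 expr1 addrK. Qed.

Lemma omS n : om n.+1 = om n * (Phi \Po om n).
Proof.
rewrite -{1}[om n]comp_polyX -comp_polyM mulX_Phi1 comp_polyB comp_polyC.
by rewrite rmorphXn /= comp_polyD comp_polyX comp_polyC omD1 -exprM -expnSr.
Qed.

(** Placing [omega_1] inside is the form suited to changes of radius, whereas [omS] exhibits the new
    factor. *)
Lemma omSr n : om n.+1 = om n \Po om 1.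
Proof.
rewrite {2}/omega_poly comp_polyB comp_polyC rmorphXn /= comp_polyD comp_polyX comp_polyC.
by rewrite omD1 -exprM -expnS.
Qed.

Lemma size_om n : size (om n) = (p ^ n).+1.
Proof.
have pn : (0 < p ^ n)%N by rewrite expn_gt0 (prime_gt0 (Qp_prime hQp)).
have e : size (('X + 1) ^+ (p ^ n) : {poly K}) = (p ^ n).+1.
  by rewrite -[X in 'X + X]opprK -polyCN size_exp_XsubC.
by rewrite /omega_poly size_polyDl // e size_polyN size_poly1 ltnS.
Qed.

Lemma om_neq0 n : om n != 0.
Proof. by rewrite -size_poly_gt0 size_om. Qed.

Lemma xi_polyS n : xi_poly K p n.+1 = Phi \Po om n.
Proof. by rewrite /xi_poly omS mulrC mulpK // om_neq0. Qed.

Lemma twistE j f : twist_poly u j f = f \Po lin (u ^ (- j)).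
Proof. by []. Qed.

Lemma lin_comp (V : K) f : lin V \Po f = V%:P * (f + 1) - 1.
Proof. by rewrite /lin comp_polyB comp_polyM comp_polyD !comp_polyC comp_polyX. Qed.

Lemma om_twist n j : om n \Po lin (u ^ (- j)) = lin (twist_pow n j) \Po om n.
Proof.
rewrite lin_comp omD1 {1}/omega_poly comp_polyB comp_polyC rmorphXn /=.
rewrite comp_polyD comp_polyX comp_polyC /lin subrK exprMn /twist_pow.
by rewrite -rmorphXn.
Qed.

Lemma xi_twist n j : twist_poly u j (xi_poly K p n.+1) = PhiV (twist_pow n j) \Po om n.
Proof. by rewrite twistE xi_polyS -comp_polyA om_twist comp_polyA. Qed.

Lemma lin_PhiV (V : K) : lin V * PhiV V = (V ^+ p)%:P * ('X + 1) ^+ p - 1.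
Proof.
rewrite /PhiV -{1}[lin V]comp_polyX -comp_polyM mulX_Phi1 comp_polyB comp_polyC.
rewrite rmorphXn /= comp_polyD comp_polyX comp_polyC /lin subrK exprMn.
by rewrite rmorphXn.
Qed.

Lemma omS_twist n j : twist_poly u j (om n.+1) = (lin (twist_pow n j) * PhiV (twist_pow n j)) \Po om n.
Proof. by rewrite twistE omS !comp_polyM -comp_polyA om_twist comp_polyA. Qed.

(** By [lin_PhiV] both products are affine in [(1 + X)^p]; eliminating this power leaves the
    non-zero constant [V^p - W^p]. *)
Lemma coprimep_lin_PhiV (V W : K) : V ^+ p != W ^+ p ->
  coprimep (lin V * PhiV V) (lin W * PhiV W).
Proof.
move=> VW; apply/Bezout_coprimepP; exists ((W ^+ p)%:P, - (V ^+ p)%:P); rewrite /= !lin_PhiV.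
set Z := ('X + 1) ^+ p.
have -> : (W ^+ p)%:P * ((V ^+ p)%:P * Z - 1) + (- (V ^+ p)%:P) * ((W ^+ p)%:P * Z - 1)
   = (V ^+ p - W ^+ p)%:P by rewrite polyCB; ring.
by rewrite -size_poly_eq1 size_polyC subr_eq0 VW.
Qed.

Lemma Phi1_mod_X : 'X %| Phi - (p%:R)%:P.
Proof.
rewrite -[ 'X]subr0 -[0]/(0%:P) dvdp_XsubCl /root !hornerE horner_coef0 (coef_Phi1 K p).
by rewrite bin1 subrr.
Qed.

Lemma PhiV_mod_lin (V : K) : lin V %| PhiV V - (p%:R)%:P.
Proof.
have := dvdp_comp_poly (lin V) Phi1_mod_X.
by rewrite comp_polyX comp_polyB comp_polyC.
Qed.

Lemma pK_neq0 : (p%:R : K) != 0.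
Proof. by apply: (natr_neq0 hQp); apply: prime_gt0 (Qp_prime hQp). Qed.

Lemma coprimep_lin_PhiV_same (V : K) : coprimep (lin V) (PhiV V).
Proof.
have /dvdpP[T eT] := PhiV_mod_lin V.
have -> : PhiV V = (p%:R)%:P + T * lin V by rewrite -eT addrC subrK.
apply/Bezout_coprimepP; exists (- T, 1); rewrite /=.
have -> : - T * lin V + 1 * (p%:R%:P + T * lin V) = (p%:R)%:P by ring.
by rewrite -size_poly_eq1 size_polyC pK_neq0.
Qed.

Section Range.
Variables (lo hi a : int) (len n : nat).
Hypotheses (lohi : lo <= hi) (sub : forall j, in_oc lo hi j -> in_J a len j).

Let s := absz (hi - lo)%R.
Let Vlo (k : nat) := twist_pow n (lo + 1 + k%:Z).
Let Va (l : nat) := twist_pow n (a + l%:Z).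
Let spec := tilde_xi_spec p u n.+1 lo hi a len.

Lemma in_oc_index j : in_oc lo hi j -> exists2 k, (k < s)%N & j = lo + 1 + k%:Z.
Proof. by rewrite /in_oc /s => /andP[h1 h2]; exists (absz (j - lo - 1)%R); lia. Qed.

Lemma index_in_oc k : (k < s)%N -> in_oc lo hi (lo + 1 + k%:Z).
Proof. by rewrite /in_oc /s; lia. Qed.

Lemma in_J_index j : in_J a len j -> exists2 l, (l < len)%N & j = a + l%:Z.
Proof. by rewrite /in_J => /andP[h1 h2]; exists (absz (j - a)%R); lia. Qed.

Lemma index_in_J l : (l < len)%N -> in_J a len (a + l%:Z).
Proof. by rewrite /in_J; lia. Qed.

Lemma twist_powX_inj i j : i != j -> twist_pow n i ^+ p != twist_pow n j ^+ p.
Proof. by move=> ij; rewrite /twist_pow -!exprM -!expnSr; apply: (twist_pow_inj n.+1). Qed.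

Lemma coprimep_twist_pow i j f g : i != j -> f %| lin (twist_pow n i) * PhiV (twist_pow n i) ->
  g %| lin (twist_pow n j) * PhiV (twist_pow n j) -> coprimep f g.
Proof.
move=> ij hf hg; apply: coprimep_dvdl hg _; apply: coprimep_dvdr hf _.
exact/coprimep_lin_PhiV/twist_powX_inj.
Qed.

(** For [j] in [J'] the congruence to 1 follows from the prescribed value [xi/p], since [PhiV V] is
    congruent to [p] modulo [lin V]. *)
Lemma spec_lin q j : spec q -> in_J a len j -> lin (twist_pow n j) \Po om n %| q - 1.
Proof.
move=> [_ h1 h2] hj; have [hoc|hoc] := boolP (in_oc lo hi j); last first.
  by have := h2 j hj hoc; rewrite twistE om_twist.
have := h1 j hoc; rewrite xi_twist omS_twist comp_polyM => h3.
have h4 := dvdp_trans (dvdp_mulr _ (dvdpp _)) h3.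
have := dvdp_comp_poly (om n) (PhiV_mod_lin (twist_pow n j)).
rewrite [(_ - (p%:R)%:P) \Po _]comp_polyB comp_polyC => h5.
have -> : q - 1 = (q - p%:R^-1 *: (PhiV (twist_pow n j) \Po om n))
            + p%:R^-1 *: ((PhiV (twist_pow n j) \Po om n) - (p%:R)%:P).
  rewrite scalerBr -[_ *: (p%:R)%:P]mul_polyC -polyCM mulVf ?pK_neq0 // polyC1.
  by rewrite addrA subrK.
by apply: dvdp_add => //; rewrite dvdpZr ?invr_eq0 ?pK_neq0.
Qed.

Lemma spec_PhiV q j : spec q -> in_oc lo hi j -> PhiV (twist_pow n j) \Po om n %| q.
Proof.
move=> [_ h1 _] hj; have := h1 j hj; rewrite xi_twist omS_twist comp_polyM => h3.
have := dvdp_trans (dvdp_mull _ (dvdpp _)) h3.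
by rewrite dvdp_subl // dvdpZr // invr_eq0 pK_neq0.
Qed.

Lemma size_comp_om (f : {poly K}) : (1 < size f)%N -> size (f \Po om n) = ((size f).-1 * p ^ n).+1.
Proof.
move=> sf; have h := size_comp_poly f (om n); rewrite size_om /= in h.
rewrite -h prednK // size_poly_gt0 comp_poly_eq0 ?size_om.
  by rewrite -size_poly_gt0; apply: ltnW.
by rewrite ltnS expn_gt0 (prime_gt0 (Qp_prime hQp)).
Qed.

(** The difference is divisible by pairwise coprime factors, [s] of degree [(p-1) p^n] and [len] of
    degree [p^n]; their total degree is the strict bound imposed on degrees. *)
Lemma spec_uniq q1 q2 : spec q1 -> spec q2 -> q1 = q2.
Proof.
move=> s1 s2; apply/eqP; rewrite -subr_eq0; apply/negP => /negP d0.
have p2 := p_gt2 hQp hodd.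
pose f k := PhiV (Vlo k) \Po om n; pose g l := lin (Va l) \Po om n.
have df k : (k < s)%N -> f k %| q1 - q2.
  by move=> hk; apply: dvdp_sub; apply: spec_PhiV => //; apply: index_in_oc.
have dg l : (l < len)%N -> g l %| q1 - q2.
  move=> hl; have -> : q1 - q2 = (q1 - 1) - (q2 - 1) by rewrite opprB addrA subrK.
  by apply: dvdp_sub; apply: spec_lin => //; apply: index_in_J.
have D : (\prod_(k < s) f k) * (\prod_(l < len) g l) %| q1 - q2.
  rewrite Gauss_dvdp; last first.
    apply: coprimep_prod_l => k hk; rewrite coprimep_sym; apply: coprimep_prod_l => l hl.
    apply: coprimep_comp; rewrite /Va /Vlo.
    (* An index [j] of [J'] occurs in both products, and then coprimality comes from [p] being
       invertible; distinct indices are separated by [twist_pow_inj]. *)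
    have [->|ij] := eqVneq (a + l%:Z) (lo + 1 + k%:Z); first exact: coprimep_lin_PhiV_same.
    by apply: (coprimep_twist_pow ij); [apply: dvdp_mulr | apply: dvdp_mull].
  apply/andP; split; apply: dvdp_prod_coprime => // i j /andP[ij _]; apply: coprimep_comp.
    by apply: (@coprimep_twist_pow (lo + 1 + i%:Z) (lo + 1 + j%:Z)); [lia|apply: dvdp_mull|apply: dvdp_mull].
  by apply: (@coprimep_twist_pow (a + i%:Z) (a + j%:Z)); [lia|apply: dvdp_mulr|apply: dvdp_mulr].
have sf k : size (f k) = (p.-1 * p ^ n).+1.
  by rewrite size_comp_om (size_PhiV hQp) ?abs_twist_pow1 //; lia.
have sg l : size (g l) = (p ^ n).+1.
  have [h _] := lin_lead (abs_unit_neq0 hQp (abs_twist_pow1 n (a + l%:Z))).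
  by rewrite size_comp_om h // mul1n.
have f0 k : f k != 0 by rewrite -size_poly_gt0 sf.
have g0 l : g l != 0 by rewrite -size_poly_gt0 sg.
have := dvdp_leq d0 D.
have F0 : \prod_(k < s) f k != 0 by apply/prodf_neq0.
have G0 : \prod_(k < len) g k != 0 by apply/prodf_neq0.
rewrite size_mul // !size_prod //.
have -> : (\sum_(k < s) size (f k) = s * (p.-1 * p ^ n).+1)%N.
  by under eq_bigr do rewrite sf; rewrite sum_nat_const card_ord.
have -> : (\sum_(l < len) size (g l) = len * (p ^ n).+1)%N.
  by under eq_bigr do rewrite sg; rewrite sum_nat_const card_ord.
rewrite !card_ord.
have : (size (q1 - q2)%R <= ((p - 1) * s + len) * p ^ n)%N.
  by case: s1 s2 => [h1 _ _] [h2 _ _]; rewrite (leq_trans (size_polyD _ _)) // size_polyN geq_max h1 h2.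
move: (size _) => z; clear -p2; rewrite subn1; move: (p.-1) (p ^ n)%N => x y; nia.
Qed.

Hypothesis len0 : (0 < len)%N.
Variable r : R.
Hypotheses (r0 : 0 < r) (hr : r ^+ p.-1 = p%:R^-1).

(** The solution of the interpolation problem in [Y], composed with [Y = omega_n], meets the
    specification of [tilde_xi]; uniqueness does the rest. *)
Lemma tilde_xi_interpolant : exists H : {poly K},
  [/\ (size H <= p.-1 * s)%N, gauss_le r (r^-1 ^+ len) H
    & tilde_xi p u n.+1 lo hi a len = (1 + H * \prod_(l < len) lin (Va l)) \Po om n].
Proof.
have [||H [h1 h2 h3]] := @interpolation R K abs p hQp hodd r r0 hr Vlo Va s _ _ len.
- by move=> k; apply: abs_twist_pow1.
- by move=> k; apply: abs_twist_pow1.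
exists H; split => //; set G := 1 + _ in h3 *.
suff hG : spec (G \Po om n).
  (* With a solution at hand, [xget] returns a solution and not its default [0]. *)
  by rewrite /tilde_xi; apply: spec_uniq (hG); apply: (xgetPex 0); exists (G \Po om n).
have p2 := p_gt2 hQp hodd.
have dG j : in_J a len j -> lin (twist_pow n j) %| G - 1.
  move=> /in_J_index[l hl ->]; rewrite /G [1 + _]addrC addrK; apply: dvdp_mull.
  by rewrite (bigD1 (Ordinal hl)) //=; apply: dvdp_mulr.
have dP j : in_oc lo hi j -> PhiV (twist_pow n j) %| G.
  move=> /in_oc_index[k hk ->]; apply: dvdp_trans h3.
  by rewrite /Psi (bigD1 (Ordinal hk)) //=; apply: dvdp_mulr.
have c1 f : (f \Po om n) - 1 = (f - 1) \Po om n by rewrite comp_polyB comp_polyC.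
have sP : size (\prod_(l < len) lin (Va l)) = len.+1.
  have sl (l : 'I_len) : size (lin (Va l)) = 2%N.
    by have [] := lin_lead (abs_unit_neq0 hQp (abs_twist_pow1 n (a + l%:Z))).
  rewrite size_prod => [|l _]; last by rewrite -size_poly_gt0 sl.
  under eq_bigr do rewrite sl.
  by rewrite sum_nat_const card_ord; lia.
have sG : (size G <= p.-1 * s + len)%N.
  rewrite (leq_trans (size_polyD _ _)) // geq_max size_poly1 addn_gt0 len0 orbT /=.
  rewrite (leq_trans (size_polyMleq _ _)) // sP addnS /=.
  by rewrite leq_add2r.
split.
- rewrite (leq_trans (size_comp_poly_leq _ _)) // size_om /= subn1.
  have pn : (0 < p ^ n)%N by rewrite expn_gt0; lia.
  have : (0 < p.-1 * s + len)%N by rewrite addn_gt0 len0 orbT.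
  move: sG pn; move: (size G) (p.-1 * s + len)%N (p ^ n)%N => x y z; nia.
- move=> j hj; rewrite xi_twist omS_twist; set V := twist_pow n j.
  rewrite -comp_polyZ -comp_polyB; apply: dvdp_comp_poly.
  (* The modulus splits into two coprime factors: modulo [PhiV V] both sides vanish, modulo [lin V]
     both are 1. *)
  rewrite Gauss_dvdp ?coprimep_lin_PhiV_same //; apply/andP; split; last first.
    by rewrite dvdp_subl ?dP // dvdpZr // invr_eq0 pK_neq0.
  have -> : G - p%:R^-1 *: PhiV V = (G - 1) - p%:R^-1 *: (PhiV V - (p%:R)%:P).
    rewrite scalerBr -[_ *: (p%:R)%:P]mul_polyC -polyCM mulVf ?pK_neq0 // polyC1.
    by rewrite opprB addrA subrK.
  apply: dvdp_sub; first by apply: dG; apply: sub.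
  by rewrite dvdpZr ?invr_eq0 ?pK_neq0 // PhiV_mod_lin.
- by move=> j hj _; rewrite twistE om_twist c1; apply: dvdp_comp_poly; apply: dG.
Qed.

End Range.

Lemma exists_radius : exists2 r : R, 0 < r & r ^+ p.-1 = p%:R^-1.
Proof.
have p2 := p_gt2 hQp hodd; have p0 := Qp_p_gt0 hQp.
exists (p%:R^-1 `^ (p.-1%:R^-1)); first by rewrite powR_gt0 // invr_gt0.
rewrite -powR_mulrn ?powR_ge0 // -powRrM mulVf ?powRr1 ?invr_ge0 ?ltW //.
by rewrite pnatr_eq0; lia.
Qed.

(* The radii [rho^(1/p^n)] of the definition of the slope, for [rho = 1/p]; they tend to [1]. *)
Definition radius (n : nat) : R := p%:R^-1 `^ (p%:R `^ (- n%:R)).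

Lemma radius_gt0 n : 0 < radius n.
Proof. by rewrite powR_gt0 // invr_gt0 (Qp_p_gt0 hQp). Qed.

Lemma radius0 : radius 0 = p%:R^-1.
Proof. by rewrite /radius oppr0 powRr0 powRr1 // invr_ge0 ltW // (Qp_p_gt0 hQp). Qed.

Lemma radiusX n : radius n.+1 ^+ p = radius n.
Proof.
have p0 := Qp_p_gt0 hQp.
rewrite /radius -powR_mulrn ?powR_ge0 // -powRrM; congr (_ `^ _).
rewrite -natr1 opprD powRD; last by rewrite (gt_eqF p0) implybT.
by rewrite [_ `^ (- 1)]powRN powRr1 ?divfK ?gt_eqF ?ltW.
Qed.

Lemma radius_lt1 n : radius n < 1.
Proof.
elim: n => [|n IH]; first by rewrite radius0 invf_lt1 ?(Qp_p_gt0 hQp) // (Qp_p_gt1 hQp).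
rewrite ltNge; apply/negP => h; have := exprn_ege1 p h.
by rewrite radiusX leNgt IH.
Qed.

Lemma pV_le_radius n : p%:R^-1 <= radius n.
Proof.
elim: n => [|n IH]; first by rewrite radius0.
apply: le_trans IH _; rewrite -radiusX -[X in _ ^+ X](prednK (prime_gt0 (Qp_prime hQp))) exprS.
by rewrite ler_piMr ?exprn_ile1 // ltW ?radius_lt1 // radius_gt0.
Qed.

(** The leading term gives [radius n.+1 ^+ p = radius n]; the other coefficients are divisible by
    [p], and [1/p <= radius n]. *)
Lemma gauss_le_om1 n : gauss_le (radius n.+1) (radius n) (om 1).
Proof.
have h0 : 0 <= radius n.+1 by rewrite ltW // radius_gt0.
rewrite omS om0 comp_polyXr => -[|k]; rewrite coefXM.
  by rewrite (abs0 hQp) mul0r ltW // radius_gt0.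
rewrite /= (coef_Phi1 K p); case: (ltngtP k.+1 p) => kp.
- apply: le_trans (pV_le_radius n); apply: (@le_trans _ _ (abs 'C(p, k.+1)%:R)).
    by rewrite ler_piMr ?(abs_ge0 hQp) // exprn_ile1 // ltW // radius_lt1.
  by apply: (abs_nat_dvd hQp); apply: prime_dvd_bin => //; apply: Qp_prime hQp.
- by rewrite bin_small // (abs0 hQp) mul0r ltW // radius_gt0.
- by rewrite kp binn (abs1 hQp) mul1r radiusX.
Qed.

(** Applying [omega_1] repeatedly brings the disc of radius [radius n] down to [radius 0 = 1/p].
    From there each further level multiplies by [Phi(omega)], of norm at most [1/p]. *)
Lemma gauss_le_om n e : gauss_le (radius n) (p%:R^-1 ^+ e.+1) (om (n + e)).
Proof.
have [r r0 hr] := exists_radius.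
have pV0 m : 0 <= (p%:R^-1 ^+ m : R) by rewrite exprn_ge0 // invr_ge0 ltW // (Qp_p_gt0 hQp).
elim: e => [|e IH].
  rewrite expr1 addn0; elim: n => [|n IH].
    by rewrite radius0 om0; apply: (gauss_le_polyX hQp); rewrite -[p%:R^-1]expr1.
  by rewrite omSr; apply: (gauss_le_comp hQp _ IH (gauss_le_om1 n)); rewrite ltW // radius_gt0.
rewrite addnS omS exprSr; apply: (gauss_leM hQp) => //; first by rewrite ltW // radius_gt0.
apply: (gauss_le_comp hQp _ _ IH); first by rewrite ltW // radius_gt0.
apply: (gauss_le_radius hQp _ _ (gauss_le_Phi1 hQp r0 hr)) => //.
exact: le_trans (pVX_le _) (pV_le_r hQp hodd r0 hr).
Qed.

(** With [Y = omega_(n+e)] of size [p^(-e-1)], each of the [len] linear factors is that small; the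
    crude bound [p^len] for [H] costs one power of [p] per factor. *)
Lemma gauss_le_tilde_xi_sub1 n e (lo hi a : int) len : (0 < len)%N -> lo <= hi ->
  (forall j, in_oc lo hi j -> in_J a len j) ->
  gauss_le (radius n) (p%:R^-1 ^+ (e * len)) (tilde_xi p u (n + e).+1 lo hi a len - 1).
Proof.
move=> len0 lohi sub; have [r r0 hr] := exists_radius.
have pV0 : 0 <= (p%:R^-1 : R) by rewrite invr_ge0 ltW // (Qp_p_gt0 hQp).
have rn0 : 0 <= radius n by rewrite ltW // radius_gt0.
have [H [_ hH ->]] := tilde_xi_interpolant (n + e) lohi sub len0 r0 hr.
rewrite comp_polyD comp_polyC addrC addKr comp_polyM rmorph_prod /=.
have rp : r^-1 <= p%:R by rewrite invf_ple ?posrE ?(Qp_p_gt0 hQp) // (pV_le_r hQp hodd r0 hr).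
have hom := gauss_le_om n e.
have -> : (p%:R^-1 : R) ^+ (e * len) = p%:R ^+ len * (p%:R^-1 ^+ e.+1) ^+ len.
  by rewrite -exprMn exprS mulVKf ?gt_eqF ?(Qp_p_gt0 hQp) // exprM.
apply: (gauss_leM hQp) => //.
  apply: (@gauss_leW _ _ _ _ (r^-1 ^+ len)).
    by rewrite lerXn2r // nnegrE ?invr_ge0 ltW // (Qp_p_gt0 hQp).
  apply: (gauss_le_comp hQp rn0 hH); apply: gauss_leW hom.
  exact: le_trans (pVX_le _) (pV_le_r hQp hodd r0 hr).
apply: (gauss_le_prod hQp) => // l.
have hV := abs_twist_pow (n + e) (a + l%:Z).
apply: (gauss_le_comp hQp rn0 _ hom); apply: (gauss_le_lin hQp).
- exact: exprn_ge0.
- by rewrite (abs_one_unit hQp (abs_twist_pow1 _ _)).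
apply: le_trans hV _; rewrite ler_wiXn2l ?ltnS ?leq_addl //.
by rewrite invf_le1 ?(Qp_p_gt0 hQp) // ltW // (Qp_p_gt1 hQp).
Qed.

Lemma gauss_le_om_unit n : gauss_le 1 1 (om n).
Proof.
apply: (gauss_leB hQp) => //; last exact: (gauss_le1 hQp).
rewrite -[X in gauss_le _ X](expr1n _ (p ^ n)); apply: (gauss_leX hQp) => //.
by apply: (gauss_leD hQp) => //; [apply: (gauss_le_polyX hQp) | apply: (gauss_le1 hQp)].
Qed.

Lemma abs_uz_le1 z : abs (u ^ z) <= 1.
Proof. by rewrite (abs_one_unit hQp (abs_uz z)). Qed.

Lemma gauss_le_lin_unit (V : K) : abs V <= 1 -> gauss_le 1 1 (lin V).
Proof.
by move=> h; apply: (gauss_le_lin hQp) => //; apply: (absB_le hQp) => //; rewrite (abs1 hQp).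
Qed.

(** As [omega_n] preserves the unit disc, the bound on [H] there gives a bound uniform in [n]. For
    [n = 0] the factors [xi_0^(j)/p] are linear with norm at most 1. *)
Lemma gauss_le_tilde_xi n (lo hi a : int) len : (0 < len)%N -> lo <= hi ->
  (forall j, in_oc lo hi j -> in_J a len j) ->
  gauss_le 1 (p%:R ^+ (`|hi - lo| + len.-1 %/ p.-1)) (tilde_xi p u n lo hi a len).
Proof.
move=> len0 lohi sub; have p1 : 1 <= (p%:R : R) by rewrite ltW // (Qp_p_gt1 hQp).
case: n => [|n].
  apply: (@gauss_leW _ _ _ _ (1 ^+ `|hi - lo|)); first by rewrite expr1n exprn_ege1.
  apply: (gauss_le_prod hQp) => // k; rewrite twistE /xi_poly comp_polyZ scalerA mulVf ?pK_neq0 //.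
  by rewrite scale1r comp_polyX; apply: gauss_le_lin_unit; apply: abs_uz_le1.
have [r r0 hr] := exists_radius.
have [H [sH hH ->]] := tilde_xi_interpolant n lohi sub len0 r0 hr.
apply: (gauss_le_comp hQp _ _ (gauss_le_om_unit n)) => //.
apply: (gauss_leD hQp) => //; first by apply: (gauss_le1 hQp); rewrite exprn_ege1.
rewrite -[X in gauss_le _ X]mulr1; apply: (gauss_leM hQp) => //.
  exact: (gauss_le_unit_disc hQp hodd r0 hr).
rewrite -[X in gauss_le _ X](expr1n _ len); apply: (gauss_le_prod hQp) => // l.
by apply: gauss_le_lin_unit; rewrite (abs_one_unit hQp (abs_twist_pow1 _ _)).
Qed.

End Interpolants.

(** * The generic unipotent matrix *)

Section GenericUnipotent.
Variables (K : fieldType) (d : nat).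

Local Notation nvar := #|{: 'I_d.+1 * 'I_d.+1}|.
Local Notation S := (mpoly nvar {poly K}).

(* The variable [lambda_(a,b)] has weight [b - a]; those with [b <= a] do not occur, and the weight
   [d + 1] given to them makes this a consequence of homogeneity. *)
Definition wt (i : 'I_nvar) : nat :=
  let ab := enum_val i in if (ab.1 < ab.2)%N then (ab.2 - ab.1)%N else d.+1.

Definition mwt (m : multinom nvar) : nat := \sum_i m i * wt i.

(** Isobaric of weight [i - j], stated additively so that entries with [i < j] are forced to
    vanish. *)
Definition graded (M : 'M[S]_d.+1) : Prop :=
  forall i j m, mcoeff m (M i j) != 0 -> (j + mwt m)%N = i.

Lemma mwt0 : mwt (@mnm0 nvar) = 0%N.
Proof. by rewrite /mwt big1 // => i _; rewrite mnmE. Qed.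

Lemma mwtD m1 m2 : mwt (mnm_add m1 m2) = (mwt m1 + mwt m2)%N.
Proof. by rewrite /mwt -big_split; apply: eq_bigr => i _; rewrite mnmE mulnDl. Qed.

Lemma mwt1 i : mwt (mnm1 i) = wt i.
Proof.
rewrite /mwt (bigD1 i) //= mnmE eqxx mul1n big1 ?addn0 // => j ij.
by rewrite mnmE eq_sym (negPf ij).
Qed.

Lemma sum_neq0 (V : nmodType) (I : finType) (P : pred I) (F : I -> V) :
  \sum_(i | P i) F i != 0 -> exists2 i, P i & F i != 0.
Proof.
move=> h; have : ~~ [forall i, P i ==> (F i == 0)].
  apply: contra h => /forallP h; apply/eqP; apply: big1 => i Pi.
  by move/implyP: (h i) => /(_ Pi)/eqP.
by rewrite negb_forall => /existsP[i]; rewrite negb_imply => /andP[h1 h2]; exists i.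
Qed.

Lemma graded_mul M1 M2 : graded M1 -> graded M2 -> graded (M1 *m M2).
Proof.
move=> h1 h2 i j m; rewrite mxE raddf_sum => /sum_neq0[l _] /=.
rewrite mcoeffM => /sum_neq0[[[m1 b1] [m2 b2]] /= /eqP em] h; rewrite {}em.
have [e1 e2] : mcoeff m1 (M1 i l) != 0 /\ mcoeff m2 (M2 l j) != 0.
  by split; apply: contraNneq h => ->; rewrite ?mul0r ?mulr0.
by rewrite mwtD addnCA addnC (h2 _ _ _ e2) (h1 _ _ _ e1).
Qed.

Lemma gradedD M1 M2 : graded M1 -> graded M2 -> graded (M1 + M2).
Proof.
move=> h1 h2 i j m; rewrite mxE mcoeffD => h.
have [e|] := eqVneq (mcoeff m (M1 i j)) 0; last exact: h1.
by apply: h2; move: h; rewrite e add0r.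
Qed.

Lemma gradedN M1 : graded M1 -> graded (- M1).
Proof. by move=> h1 i j m; rewrite mxE mcoeffN oppr_eq0; apply: h1. Qed.

Lemma graded_diag (D : 'I_d.+1 -> {poly K}) : graded (diag_mx (\row_i mpolyC nvar (D i))).
Proof.
move=> i j m; rewrite !mxE; have [->|ij] := eqVneq i j; last by rewrite mulr0n mcoeff0 eqxx.
rewrite mulr1n mcoeffC; have [->|m0] := eqVneq m (@mnm0 nvar); first by rewrite mwt0 addn0.
by rewrite mulr0 eqxx.
Qed.

Lemma graded1 : graded 1.
Proof.
have -> : (1 : 'M[S]_d.+1) = diag_mx (\row_i mpolyC nvar 1).
  by apply/matrixP => i j; rewrite !mxE.
exact: graded_diag.
Qed.

Lemma graded_lower M (i j : 'I_d.+1) : graded M -> (i < j)%N -> M i j = 0.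
Proof.
move=> h ij; apply/mpolyP => m; rewrite mcoeff0; apply/eqP; apply: contraTT ij => /h e.
by rewrite -leqNgt -e leq_addr.
Qed.

(** The indices are exchanged because [Q] is the transpose of [P]. *)
Definition Lgen : 'M[S]_d.+1 :=
  \matrix_(i, j) if (j < i)%N then mpolyX {poly K} (mnm1 (enum_rank (j, i))) else 0.

Definition Qgen : 'M[S]_d.+1 := 1 + Lgen.
(** The geometric series for the inverse, finite by nilpotency; its coefficients are visibly
    integral. *)
Definition Qinv : 'M[S]_d.+1 := \sum_(k < d.+1) (- Lgen) ^+ k.

Lemma graded_Lgen : graded Lgen.
Proof.
move=> i j m; rewrite mxE; case: ifP => [ji|_]; last by rewrite mcoeff0 eqxx.
rewrite mcoeffX; case: (mnm1 _ =P m) => [<- _|_]; last by rewrite eqxx.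
by rewrite mwt1 /wt enum_rankK /= ji subnKC // ltnW.
Qed.

Lemma graded_Qgen : graded Qgen.
Proof. exact: gradedD graded1 graded_Lgen. Qed.

Lemma graded_exp M k : graded M -> graded (M ^+ k).
Proof.
move=> h; elim: k => [|k IH]; first by rewrite expr0; apply: graded1.
by rewrite exprS; apply: graded_mul.
Qed.

Lemma graded_Qinv : graded Qinv.
Proof.
rewrite /Qinv; elim/big_ind: _ => [|M1 M2|k _]; last by apply/graded_exp/gradedN/graded_Lgen.
  by move=> i j m; rewrite mxE mcoeff0 eqxx.
exact: gradedD.
Qed.

Lemma Lgen_nilpotent : (- Lgen) ^+ d.+1 = 0.
Proof.
(* Each factor moves the support one diagonal further down. *)
suff h k (i j : 'I_d.+1) : (i < j + k)%N -> ((- Lgen) ^+ k) i j = 0.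
  by apply/matrixP => i j; rewrite h ?mxE // (leq_trans (ltn_ord i)) // leq_addl.
elim: k i j => [|k IH] i j hij.
  by rewrite expr0 mxE; case: eqP hij => // ->; rewrite addn0 ltnn.
rewrite exprS mxE big1 // => l _; rewrite !mxE; case: ifP => li; last by rewrite oppr0 mul0r.
by rewrite IH ?mulr0 //; move: hij li; lia.
Qed.

Lemma Qgen_Qinv : Qgen *m Qinv = 1.
Proof.
have := subrX1 (- Lgen) d.+1; rewrite Lgen_nilpotent sub0r => /(congr1 -%R).
by rewrite opprK -mulNr opprB opprK => ->.
Qed.

Lemma Qinv_Qgen : Qinv *m Qgen = 1.
Proof. exact: mulmx1C Qgen_Qinv. Qed.

End GenericUnipotent.

(** * Gauss norms with the [lambda_(i,j)] as indeterminates *)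

Section GenericNorm.
Variables (R : realType) (K : fieldType) (abs : K -> R) (p : nat).
Hypothesis hQp : is_Qp abs p.
Variable d : nat.
Local Notation nvar := #|{: 'I_d.+1 * 'I_d.+1}|.
Local Notation S := (mpoly nvar {poly K}).

(** The indeterminates [lambda_(i,j)] are given radius 1, hence no weighting by the multinomial. *)
Definition mgauss_le (r B : R) (f : S) : Prop := forall m, gauss_le abs r B (mcoeff m f).
Definition mxgauss_le (r B : R) (M : 'M[S]_d.+1) : Prop := forall i j, mgauss_le r B (M i j).

Variable r : R.
Hypothesis r0 : 0 <= r.

Lemma mgauss_le_ge0 B f : mgauss_le r B f -> 0 <= B.
Proof. by move=> /(_ (@mnm0 nvar)); apply: (gauss_le_ge0 hQp). Qed.

Lemma mgauss_leW B B' f : B <= B' -> mgauss_le r B f -> mgauss_le r B' f.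
Proof. by move=> h hf m; apply: gauss_leW h (hf m). Qed.

Lemma mgauss_le0 B : 0 <= B -> mgauss_le r B 0.
Proof. by move=> B0 m; rewrite mcoeff0; apply: (gauss_le0 hQp). Qed.

Lemma mgauss_leC B c : gauss_le abs r B c -> mgauss_le r B (mpolyC nvar c).
Proof.
move=> h m; rewrite mcoeffC; case: (m == _); first by rewrite mulr1.
by rewrite mulr0; apply: (gauss_le0 hQp); apply: (gauss_le_ge0 hQp h).
Qed.

Lemma mgauss_leD B f g : mgauss_le r B f -> mgauss_le r B g -> mgauss_le r B (f + g).
Proof. by move=> hf hg m; rewrite mcoeffD; apply: (gauss_leD hQp). Qed.

Lemma mgauss_le_sum (I : Type) (s : seq I) (P : pred I) (F : I -> S) B :
  0 <= B -> (forall i, P i -> mgauss_le r B (F i)) -> mgauss_le r B (\sum_(i <- s | P i) F i).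
Proof.
move=> B0 h; elim/big_ind: _ => //; first exact: mgauss_le0.
by move=> f g; apply: mgauss_leD.
Qed.

Lemma mgauss_leM B C f g : mgauss_le r B f -> mgauss_le r C g -> mgauss_le r (B * C) (f * g).
Proof.
move=> hf hg m; rewrite mcoeffM; apply: (gauss_le_sum hQp) => //.
  by rewrite mulr_ge0 // ?(mgauss_le_ge0 hf) ?(mgauss_le_ge0 hg).
by move=> k _; apply: (gauss_leM hQp).
Qed.

Lemma mxgauss_le_ge0 B M : mxgauss_le r B M -> 0 <= B.
Proof. by move=> /(_ ord0 ord0); apply: mgauss_le_ge0. Qed.

Lemma mxgauss_le_mul B C M1 M2 : mxgauss_le r B M1 -> mxgauss_le r C M2 -> mxgauss_le r (B * C) (M1 *m M2).
Proof.
move=> h1 h2 i j; rewrite mxE; apply: mgauss_le_sum => [|l _]; last exact: mgauss_leM.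
by rewrite mulr_ge0 // ?(mxgauss_le_ge0 h1) ?(mxgauss_le_ge0 h2).
Qed.

Lemma mxgauss_leW B B' M : B <= B' -> mxgauss_le r B M -> mxgauss_le r B' M.
Proof. by move=> h hf i j; apply: mgauss_leW h (hf i j). Qed.

Lemma mxgauss_leD B M1 M2 : mxgauss_le r B M1 -> mxgauss_le r B M2 -> mxgauss_le r B (M1 + M2).
Proof. by move=> h1 h2 i j; rewrite mxE; apply: mgauss_leD. Qed.

Lemma mxgauss_le_diag B (D : 'I_d.+1 -> {poly K}) : 0 <= B -> (forall i, gauss_le abs r B (D i)) ->
  mxgauss_le r B (diag_mx (\row_i mpolyC nvar (D i))).
Proof.
move=> B0 h i j; rewrite !mxE; case: eqP => [->|_]; last by rewrite mulr0n; apply: mgauss_le0.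
by rewrite mulr1n; apply: mgauss_leC.
Qed.

Lemma mxgauss_le1 : mxgauss_le r 1 1.
Proof.
have -> : (1 : 'M[S]_d.+1) = diag_mx (\row_i mpolyC nvar 1).
  by apply/matrixP => i j; rewrite !mxE.
by apply: mxgauss_le_diag => // i; apply: (gauss_le1 hQp).
Qed.

Lemma mxgauss_le_Lgen : mxgauss_le r 1 (- Lgen K d).
Proof.
move=> i j; rewrite !mxE; case: ifP => _; last by rewrite oppr0; apply: mgauss_le0.
move=> m; rewrite mcoeffN mcoeffX; apply: (gauss_leN hQp).
by case: (_ == _); [apply: (gauss_le1 hQp) | apply: (gauss_le0 hQp)].
Qed.

Lemma mxgauss_le_Qgen : mxgauss_le r 1 (Qgen K d).
Proof.
apply: mxgauss_leD; first exact: mxgauss_le1.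
move=> i j; rewrite -[Lgen K d]opprK mxE => m; rewrite mcoeffN; apply: (gauss_leN hQp).
exact: mxgauss_le_Lgen.
Qed.

Lemma mxgauss_le_Qinv : mxgauss_le r 1 (Qinv K d).
Proof.
rewrite /Qinv; elim/big_ind: _ => [|M1 M2|k _].
- by move=> i j; rewrite mxE; apply: mgauss_le0.
- exact: mxgauss_leD.
elim: (nat_of_ord k) => [|n IH]; first by rewrite expr0; apply: mxgauss_le1.
by rewrite exprS -[1]mulr1; apply: mxgauss_le_mul => //; apply: mxgauss_le_Lgen.
Qed.

(** Row [i] of the lower triangular [Qinv] only meets the [D l] with [l <= i]; this restriction
    survives as the condition [i <= k] in the slope. *)
Lemma conj_Qgen_entry (D : 'I_d.+1 -> {poly K}) (i j : 'I_d.+1) B : 0 <= B ->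
  (forall l : 'I_d.+1, (l <= i)%N -> gauss_le abs r B (D l)) ->
  mgauss_le r B ((Qinv K d *m diag_mx (\row_l mpolyC nvar (D l)) *m Qgen K d) i j).
Proof.
move=> B0 h; rewrite mxE; apply: mgauss_le_sum => // l _.
rewrite mul_mx_diag [X in X * _]mxE [X in _ * X * _]mxE.
have [il|li] := ltnP i l.
  by rewrite (graded_lower (@graded_Qinv K d) il) !mul0r; apply: mgauss_le0.
rewrite -[B]mul1r -[1 * B]mulr1; apply: mgauss_leM; last exact: mxgauss_le_Qgen.
by apply: mgauss_leM; [apply: mxgauss_le_Qinv | apply: mgauss_leC; apply: h].
Qed.

End GenericNorm.

(** * Products of the generic matrices *)

(** All factors equal 1 from the first index where [c theta^k <= 1], so the product up to this index
    is a bound. *)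
Lemma prod_max1_bounded (R : realType) (c theta : R) : 0 <= c -> 0 <= theta < 1 ->
  exists2 C : R, 1 <= C & forall n, \prod_(k < n) Num.max 1 (c * theta ^+ k) <= C.
Proof.
move=> c0 /andP[t0 t1].
have [k0 hk0] : exists k0, c * theta ^+ k0 <= 1.
  have h : (fun k => c * theta ^+ k) @ \oo --> (c * 0 : R).
    by apply: cvgMr; apply: cvg_expr; rewrite ger0_norm.
  rewrite mulr0 in h; have := cvgr_le _ h 1 ltr01.
  by move=> [k0 _ hk]; exists k0; apply: hk => /=.
have F1 k : 1 <= Num.max 1 (c * theta ^+ k) by rewrite le_max lexx.
have P1 n : 1 <= \prod_(k < n) Num.max 1 (c * theta ^+ k) by elim/big_ind: _ => // x y hx hy; apply: mulr_ege1.
exists (\prod_(k < k0) Num.max 1 (c * theta ^+ k)) => // n.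
have [nk|kn] := leqP n k0.
  rewrite -(subnKC nk); elim: (k0 - n)%N => [|j IH]; first by rewrite addn0.
  apply: le_trans IH _; rewrite addnS big_ord_recr /= ler_peMr //.
  exact: le_trans ler01 (P1 _).
rewrite -(subnKC (ltnW kn)); elim: (n - k0)%N => [|j IH]; first by rewrite addn0.
rewrite addnS big_ord_recr /= [X in _ * X](_ : _ = 1) ?mulr1 //.
apply/max_idPl; apply: le_trans hk0; rewrite ler_wpM2l // ler_wiXn2l ?leq_addr //.
exact: ltW.
Qed.

Section MatrixTelescope.
Variables (T : nzRingType) (n : nat).
Implicit Types X M A B : 'M[T]_n.+1.

Lemma telescope_right X M A0 A1 B B' : B *m B' = 1 ->
  X *m (A0 *m A1 *m M *m B) *m B' = (X *m A0) *m (A1 *m M).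
Proof. by move=> BB; rewrite -!mulmxA BB mulmx1. Qed.

Lemma telescope_conj X M A0 A1 B0 B1 : B0 *m A0 = 1 ->
  X *m (A0 *m A1 *m M *m (B1 *m B0)) *m A0 = (X *m A0) *m (A1 *m M *m B1).
Proof. by move=> BA; rewrite -!mulmxA BA mulmx1. Qed.

Lemma telescope_sub X M A0 A1 B0 B1 : A0 *m B0 = 1 -> A1 *m B1 = 1 ->
  X *m (A0 *m A1 *m M *m (B1 *m B0)) - X = (X *m A0) *m (A1 *m (M - 1) *m B1) *m B0.
Proof.
move=> AB0 AB1; rewrite mulmxBr mulmxBl mulmx1 AB1 mulmxBr mulmx1 mulmxBl -!mulmxA AB0.
by rewrite mulmx1.
Qed.

Lemma telescope_pad X A0 A1 B1 : A1 *m B1 = 1 -> X *m A0 = X *m (A0 *m A1) *m B1.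
Proof. by move=> AB; rewrite -!mulmxA AB mulmx1. Qed.

Lemma conj_sub1 M A B : A *m B = 1 -> A *m M *m B = A *m (M - 1) *m B + 1.
Proof. by move=> AB; rewrite mulmxBr mulmxBl mulmx1 AB subrK. Qed.

End MatrixTelescope.

(** * Growth and convergence of the generic product *)

Section Iteration.
Variables (R : realType) (K : fieldType) (abs : K -> R) (p : nat).
Hypothesis hQp : is_Qp abs p.
Variables (d N : nat) (alpha : 'I_d.+1 -> K) (tau : nat -> 'I_d.+1 -> {poly K}).
Hypothesis alpha0 : forall i, alpha i != 0.

Local Notation nvar := #|{: 'I_d.+1 * 'I_d.+1}|.
Local Notation S := (mpoly nvar {poly K}).
Local Notation cst := (mpolyC nvar).
Local Notation radius := (radius R p).
Local Notation mxgauss_le := (mxgauss_le abs).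

Definition Agen k : 'M[S]_d.+1 := diag_mx (\row_i cst (alpha i ^+ k)%:P).
Definition AgenV k : 'M[S]_d.+1 := diag_mx (\row_i cst ((alpha i)^-1 ^+ k)%:P).
Definition Mgen m : 'M[S]_d.+1 :=
  Qinv K d *m diag_mx (\row_i cst (tau m i)) *m Qgen K d.

(** The matrix of the partial products in the basis of eigenvectors, before the [lambda_(i,j)] are
    specialised (see [Zseq_eval]). *)
Fixpoint Xgen k : 'M[S]_d.+1 :=
  if k is k'.+1 then Xgen k' *m (AgenV (N + k').+1 *m Mgen (N + k') *m Agen (N + k').+1) else 1.

Lemma graded_Mgen m : graded (Mgen m).
Proof.
apply: graded_mul; last exact: graded_Qgen.
by apply: graded_mul; [apply: graded_Qinv | apply: graded_diag].
Qed.

Lemma graded_Xgen k : graded (Xgen k).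
Proof.
elim: k => [|k IH]; first exact: graded1.
apply: graded_mul => //; apply: graded_mul; last exact: graded_diag.
by apply: graded_mul; [apply: graded_diag | apply: graded_Mgen].
Qed.

Lemma AgenD k l : Agen (k + l) = Agen k *m Agen l.
Proof.
rewrite /Agen mulmx_diag; congr diag_mx; apply/rowP => i.
by rewrite !mxE exprD polyCM mpolyCM.
Qed.

Lemma AgenVD k l : AgenV (k + l) = AgenV k *m AgenV l.
Proof.
rewrite /AgenV mulmx_diag; congr diag_mx; apply/rowP => i.
by rewrite !mxE exprD polyCM mpolyCM.
Qed.

Lemma Agen_AgenV k : Agen k *m AgenV k = 1.
Proof.
rewrite /Agen /AgenV mulmx_diag; apply/matrixP => i j; rewrite !mxE.
by rewrite -mpolyCM -polyCM -exprMn divff // expr1n.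
Qed.

Lemma AgenV_Agen k : AgenV k *m Agen k = 1.
Proof. exact: mulmx1C (Agen_AgenV k). Qed.

Lemma conj_Agen_entry k M i j :
  (AgenV k *m M *m Agen k) i j = cst ((alpha j / alpha i) ^+ k)%:P * M i j.
Proof.
rewrite mul_mx_diag [LHS]mxE mul_diag_mx [X in X * _]mxE.
rewrite [X in X * _ * _]mxE [X in _ * _ * X]mxE mulrAC -mpolyCM -polyCM -exprMn.
by rewrite [_^-1 * _]mulrC.
Qed.

Lemma Mgen_sub1 m : Mgen m - 1 = Qinv K d *m diag_mx (\row_i cst (tau m i - 1)) *m Qgen K d.
Proof.
have -> : diag_mx (\row_i cst (tau m i - 1)) = diag_mx (\row_i cst (tau m i)) - 1 :> 'M[S]_d.+1.
  apply/matrixP => i j; rewrite !mxE mpolyCB.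
  by case: (i == j); rewrite ?mulr1n // !mulr0n subr0.
by rewrite mulmxBr mulmxBl mulmx1 Qinv_Qgen.
Qed.

(** [b] bounds the eigenvalue ratios produced by conjugation below the diagonal, [q] (later
    [p^(-|J|)]) is the rate at which [tau] tends to 1, and [Lam] is the growth per factor, which
    determines the slope. *)
Variables (b Lam q : R) (tauB : 'I_d.+1 -> R).
Hypotheses (hb : forall i j : 'I_d.+1, (j <= i)%N -> abs (alpha j / alpha i) <= b)
  (Lam0 : 0 <= Lam) (hLam1 : forall i, (abs (alpha i))^-1 <= Lam)
  (tau1 : forall m l, gauss_le abs 1 (tauB l) (tau m l))
  (hLam2 : forall i l : 'I_d.+1, (l <= i)%N -> (abs (alpha i))^-1 * tauB l <= Lam)
  (q0 : 0 <= q) (bq : b * q < 1)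
  (tau2 : forall n e l, gauss_le abs (radius n) (q ^+ e) (tau (n + e).+1 l - 1)).

Lemma b_ge0 : 0 <= b.
Proof. by apply: le_trans (hb (leqnn ord0)); apply: (abs_ge0 hQp). Qed.

Let radius_ge0 n : 0 <= radius n. Proof. exact: ltW (radius_gt0 hQp n). Qed.
Let radius_le1 n : radius n <= 1. Proof. exact: ltW (radius_lt1 hQp n). Qed.

Lemma mxgauss_le_AgenV r k : 0 <= r -> mxgauss_le r (Lam ^+ k) (AgenV k).
Proof.
move=> r0; apply: (mxgauss_le_diag hQp) => //; first exact: exprn_ge0.
move=> i; apply: (gauss_leC hQp); rewrite (absX hQp) (absV hQp) lerXn2r // nnegrE //.
by rewrite invr_ge0 (abs_ge0 hQp).
Qed.

Definition sum_alpha : R := \sum_i abs (alpha i).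

Lemma abs_alpha_le i : abs (alpha i) <= sum_alpha.
Proof. by rewrite /sum_alpha (bigD1 i) //= lerDl sumr_ge0 // => j _; apply: (abs_ge0 hQp). Qed.

Lemma sum_alpha_ge0 : 0 <= sum_alpha.
Proof. by rewrite sumr_ge0 // => j _; apply: (abs_ge0 hQp). Qed.

Lemma mxgauss_le_Agen r k : 0 <= r -> mxgauss_le r (sum_alpha ^+ k) (Agen k).
Proof.
move=> r0; apply: (mxgauss_le_diag hQp) => //; first exact: exprn_ge0 sum_alpha_ge0.
move=> i; apply: (gauss_leC hQp); rewrite (absX hQp) lerXn2r // ?nnegrE ?sum_alpha_ge0 ?(abs_ge0 hQp) //.
exact: abs_alpha_le.
Qed.

(** Row [i] combines [1/alpha_i] with the [tau m l] for [l <= i] only, which is exactly what [hLam2]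
    controls. *)
Lemma mxgauss_le_AgenV_Mgen m : mxgauss_le 1 Lam (AgenV 1 *m Mgen m).
Proof.
move=> i j; rewrite mul_diag_mx [X in mgauss_le _ _ _ X]mxE [X in X * _]mxE expr1.
have ai : 0 < (abs (alpha i))^-1 by rewrite invr_gt0 (abs_gt0 hQp).
rewrite -[Lam](mulVKf (lt0r_neq0 ai)).
apply: (mgauss_leM hQp) => //; first by apply: (mgauss_leC hQp); apply: (gauss_leC hQp); rewrite (absV hQp).
apply: (conj_Qgen_entry hQp) => //; first by rewrite mulr_ge0 // invr_ge0 ltW.
move=> l li; apply: gauss_leW (tau1 m l).
by rewrite ler_pdivlMl // hLam2.
Qed.

(* The right factor [A^(-N-k)] regroups the product into the factors [A^(-1) M_m], whose norm on the
   unit disc does not grow with [m]. *)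
Lemma mxgauss_le_Xgen_diagonal k : mxgauss_le 1 (Lam ^+ (N + k)) (Xgen k *m AgenV (N + k)).
Proof.
elim: k => [|k IH]; first by rewrite mul1mx addn0; apply: mxgauss_le_AgenV.
have -> : Xgen k.+1 *m AgenV (N + k.+1) = (Xgen k *m AgenV (N + k)) *m (AgenV 1 *m Mgen (N + k)).
  rewrite /= addnS -[(N + k).+1]addn1 AgenVD; apply: telescope_right.
  by rewrite -AgenVD Agen_AgenV.
by rewrite addnS exprSr; exact: (mxgauss_le_mul hQp ler01 IH (mxgauss_le_AgenV_Mgen (N + k))).
Qed.

(** The factor of index [n + e + 1] is conjugated by [A^(n+e+2)]. Once [A^n] is set aside, [A^(e+2)]
    contributes [b^(e+2)] and [tau - 1] contributes [q^e]. *)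
Definition conj_factor e : R := b ^+ e.+2 * q ^+ e.

Lemma conj_factor_ge0 e : 0 <= conj_factor e.
Proof. by rewrite mulr_ge0 // exprn_ge0 // b_ge0. Qed.

Lemma conj_factorE e : conj_factor e = b ^+ 2 * (b * q) ^+ e.
Proof. by rewrite /conj_factor -addn2 addnC exprD exprMn mulrA. Qed.

Lemma conj_factor_le e j : (j <= e)%N -> conj_factor e <= conj_factor j.
Proof.
move=> je; rewrite !conj_factorE ler_wpM2l ?exprn_ge0 ?b_ge0 // ler_wiXn2l //.
  by rewrite mulr_ge0 // b_ge0.
exact: ltW.
Qed.

(** Entries above the diagonal vanish by the grading, so only the ratios bounded by [hb] occur. *)
Lemma mxgauss_le_conj_sub1 n e :
  mxgauss_le (radius n) (conj_factor e) (AgenV e.+2 *m (Mgen (n + e).+1 - 1) *m Agen e.+2).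
Proof.
move=> i j; rewrite conj_Agen_entry; have [ij|ji] := ltnP i j.
  have g1 : graded (Mgen (n + e).+1 - 1).
    by apply: gradedD; [apply: graded_Mgen | apply/gradedN/graded1].
  by rewrite (graded_lower g1 ij) mulr0; apply: (mgauss_le0 hQp) => //; apply: conj_factor_ge0.
apply: (mgauss_leM hQp) => //.
  apply: (mgauss_leC hQp); apply: (gauss_leC hQp); rewrite (absX hQp) lerXn2r // ?nnegrE ?b_ge0 ?hb //.
  exact: (abs_ge0 hQp).
by rewrite Mgen_sub1; apply: (conj_Qgen_entry hQp) => //; apply: exprn_ge0.
Qed.

Lemma mxgauss_le_conj n e :
  mxgauss_le (radius n) (Num.max 1 (conj_factor e)) (AgenV e.+2 *m Mgen (n + e).+1 *m Agen e.+2).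
Proof.
rewrite (conj_sub1 _ (AgenV_Agen e.+2)); apply: (mxgauss_leD hQp) => //.
  by apply: (mxgauss_leW (_ : conj_factor e <= _)); [rewrite le_max lexx orbT | apply: mxgauss_le_conj_sub1].
by apply: (mxgauss_leW (_ : 1 <= _)); [rewrite le_max lexx | apply: (mxgauss_le1 hQp)].
Qed.

Lemma Xgen_step n e k : (N + k = (n + e).+1)%N ->
  Xgen k.+1 *m AgenV n = (Xgen k *m AgenV n) *m (AgenV e.+2 *m Mgen (n + e).+1 *m Agen e.+2).
Proof.
move=> h; rewrite /= h; have -> : (n + e).+2 = (n + e.+2)%N by rewrite !addnS.
by rewrite AgenVD [in Agen _]addnC AgenD; apply: telescope_conj; apply: Agen_AgenV.
Qed.

Lemma Xgen_diff n e k : (N + k = (n + e).+1)%N ->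
  Xgen k.+1 - Xgen k =
    (Xgen k *m AgenV n) *m (AgenV e.+2 *m (Mgen (n + e).+1 - 1) *m Agen e.+2) *m Agen n.
Proof.
move=> h; rewrite /= h; have -> : (n + e).+2 = (n + e.+2)%N by rewrite !addnS.
by rewrite AgenVD [in Agen _]addnC AgenD; apply: telescope_sub; apply: AgenV_Agen.
Qed.

(* On the disc of radius [radius n] the factors of index at most [n] are bounded on the unit disc, and
   those of index [m > n] converge geometrically to [1] once conjugated by [A^n]. *)
Lemma mxgauss_le_Xgen_disc : exists2 C : R, 0 <= C &
  forall n k, (n < N + k)%N -> mxgauss_le (radius n) (C * Lam ^+ n) (Xgen k *m AgenV n).
Proof.
have bq0 : 0 <= b * q by rewrite mulr_ge0 // b_ge0.
have [|C1 C11 hC1] := @prod_max1_bounded _ (b ^+ 2) (b * q) (exprn_ge0 _ b_ge0).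
  by rewrite bq0.
(* [Lam * sum_alpha] pays for replacing [A^(-n-1)] by [A^(-n)]; the 1 is for the case where no
   factor has index at most [n]. *)
pose C0 := Num.max 1 (Lam * sum_alpha).
have C00 : 0 <= C0 by rewrite le_max ler01.
have C10 : 0 <= C1 by rewrite (le_trans ler01).
exists (C0 * C1); first exact: mulr_ge0.
(* [Xgen k0] collects exactly the factors of index at most [n]; the truncated subtraction makes it
   empty when [n < N]. *)
move=> n k hnk; pose k0 := (n.+1 - N)%N; have hk0 : (k0 <= k)%N by rewrite /k0; lia.
rewrite -(subnKC hk0); move: (k - k0)%N => {hnk hk0} j.
apply: (@mxgauss_leW _ _ _ _ _ (C0 * Lam ^+ n * \prod_(i < j) Num.max 1 (b ^+ 2 * (b * q) ^+ i))).
  by rewrite mulrAC ler_wpM2r ?exprn_ge0 // ler_wpM2l.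
elim: j => [|j IH].
  rewrite big_ord0 mulr1 addn0; have [hN|hN] := leqP N n.+1.
    have e : (N + k0 = n.+1)%N by rewrite subnKC.
    have -> : Xgen k0 *m AgenV n = Xgen k0 *m AgenV n.+1 *m Agen 1.
      by rewrite -[n.+1]addn1 AgenVD; apply: telescope_pad; apply: AgenV_Agen.
    have h := mxgauss_le_Xgen_diagonal k0; rewrite e in h.
    apply: (@mxgauss_leW _ _ _ _ _ (Lam ^+ n.+1 * sum_alpha ^+ 1)).
      by rewrite expr1 exprSr -mulrA mulrC ler_wpM2r ?exprn_ge0 // le_max lexx orbT.
    apply: (mxgauss_le_mul hQp (radius_ge0 n) _ (mxgauss_le_Agen 1 (radius_ge0 n))) => i' j' m.
    exact: (gauss_le_radius hQp (radius_ge0 n) (radius_le1 n) (h i' j' m)).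
  have -> : k0 = 0%N by rewrite /k0; lia.
  rewrite mul1mx; apply: mxgauss_leW (mxgauss_le_AgenV _ (radius_ge0 n)).
  by rewrite ler_peMl ?exprn_ge0 // le_max lexx.
pose e := (N + (k0 + j) - n.+1)%N.
have he : (N + (k0 + j) = (n + e).+1)%N by rewrite /e /k0; lia.
have je : (j <= e)%N by rewrite /e /k0; lia.
rewrite addnS (Xgen_step he) big_ord_recr /= mulrA; apply: (mxgauss_le_mul hQp (radius_ge0 n) IH).
apply: mxgauss_leW (mxgauss_le_conj n e).
by rewrite ge_max !le_max lexx /= -conj_factorE conj_factor_le // orbT.
Qed.

(** On a fixed disc the outer powers of [A] are constants, and the inner factor decays
    geometrically: the sequence is Cauchy there. *)
Lemma mxgauss_le_Xgen_diff n : exists k0 D, forall j,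
  mxgauss_le (radius n) (D * (b * q) ^+ j) (Xgen (k0 + j).+1 - Xgen (k0 + j)).
Proof.
have [C C0 hC] := mxgauss_le_Xgen_disc.
exists (n.+1 - N)%N, (C * Lam ^+ n * b ^+ 2 * sum_alpha ^+ n) => j; set k0 := (_ - _)%N.
pose e := (N + (k0 + j) - n.+1)%N.
have he : (N + (k0 + j) = (n + e).+1)%N by rewrite /e /k0; lia.
have je : (j <= e)%N by rewrite /e /k0; lia.
have hnk : (n < N + (k0 + j))%N by rewrite he; lia.
apply: (@mxgauss_leW _ _ _ _ _ (C * Lam ^+ n * conj_factor e * sum_alpha ^+ n)).
  rewrite -[leRHS]mulrAC ler_wpM2r ?exprn_ge0 ?sum_alpha_ge0 // -[leRHS]mulrA ler_wpM2l //.
    by rewrite mulr_ge0 // exprn_ge0.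
  by rewrite -conj_factorE conj_factor_le.
rewrite (Xgen_diff he); apply: (mxgauss_le_mul hQp (radius_ge0 n) _ (mxgauss_le_Agen n (radius_ge0 n))).
exact: (mxgauss_le_mul hQp (radius_ge0 n) (hC _ _ hnk) (mxgauss_le_conj_sub1 n e)).
Qed.

End Iteration.

(** * Limits and evaluation *)

Lemma geometric_cvg0 (R : realType) (D theta : R) : 0 <= theta < 1 ->
  (fun j => D * theta ^+ j) @ \oo --> (0 : R).
Proof.
move=> /andP[t0 t1]; have h : (fun k => D * theta ^+ k) @ \oo --> (D * 0 : R).
  by apply: cvgMr; apply: cvg_expr; rewrite ger0_norm.
by rewrite mulr0 in h.
Qed.

Lemma geometric_lt (R : realType) (D theta e : R) : 0 <= theta < 1 -> 0 < e ->
  exists j, D * theta ^+ j < e.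
Proof.
move=> ht e0; have [j _ hj] := cvgr_lt _ (geometric_cvg0 D ht) _ e0.
by exists j; apply: hj => /=.
Qed.

Lemma le_max_geometric (R : realType) (D theta B x : R) : 0 <= theta < 1 -> 0 <= B ->
  (forall j, x <= Num.max (D * theta ^+ j) B) -> x <= B.
Proof.
move=> ht B0 h; rewrite leNgt; apply/negP => Bx.
have [j hj] := geometric_lt D ht (le_lt_trans B0 Bx).
by have := h j; rewrite leNgt gt_max hj Bx.
Qed.

Section Limits.
Variables (R : realType) (K : fieldType) (abs : K -> R) (p : nat).
Hypothesis hQp : is_Qp abs p.

Local Notation radius := (radius R p).

(** Otherwise [1/p = radius n ^+ (p ^ n) <= rho ^+ (p ^ n)] for all [n], although [rho < 1]. *)
Lemma radius_to1 rho : 0 < rho < 1 -> exists n, rho < radius n.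
Proof.
move=> /andP[r0 r1]; apply/not_existsP => h.
have hh n : radius n <= rho by have /negP := h n; rewrite -leNgt.
have rrp n : radius n ^+ (p ^ n) = p%:R^-1.
  elim: n => [|n IH]; first by rewrite expr1 radius0.
  by rewrite expnS exprM (radiusX hQp) IH.
have p1 := prime_gt1 (Qp_prime hQp).
have [||j hj] := @geometric_lt _ 1 rho p%:R^-1.
- by rewrite ltW.
- by rewrite invr_gt0 (Qp_p_gt0 hQp).
move: hj; rewrite mul1r ltNge => /negP; apply; rewrite -(rrp j).
apply: (@le_trans _ _ (rho ^+ (p ^ j))).
  by rewrite lerXn2r // nnegrE ltW // (radius_gt0 hQp).
by apply: ler_wiXn2l; [apply: ltW | apply: ltW | apply/ltnW/ltn_expl].
Qed.

Section Sequence.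
Variables (f : nat -> nat -> K) (theta : R).
Hypothesis ht : 0 <= theta < 1.

Definition geometric_step n k0 D := forall j m,
  abs (f (k0 + j).+1 m - f (k0 + j)%N m) * radius n ^+ m <= D * theta ^+ j.

Lemma geometric_step_tail n k0 D j i m : geometric_step n k0 D ->
  abs (f (k0 + j + i)%N m - f (k0 + j)%N m) * radius n ^+ m <= D * theta ^+ j.
Proof.
move=> h; have [t0 t1] := andP ht; have r0 := exprn_gt0 m (radius_gt0 hQp n).
have D0 : 0 <= D.
  have := h 0%N 0%N; rewrite expr0 !mulr1 => h0.
  exact: (le_trans (abs_ge0 hQp _) h0).
rewrite -ler_pdivlMr //; elim: i => [|i IH].
  by rewrite addn0 subrr (abs0 hQp) (divr_ge0 (mulr_ge0 D0 (exprn_ge0 j t0)) (ltW r0)).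
rewrite addnS -[f _.+1 m](subrK (f (k0 + j + i)%N m)) -addrA.
apply: (absD_le hQp) => //; rewrite ler_pdivlMr // -addnA; apply: le_trans (h _ _) _.
by rewrite ler_wpM2l // ler_wiXn2l ?leq_addr // ltW.
Qed.

(** One disc suffices to construct [l] coefficientwise; this same [l] then inherits the rate of
    convergence of every other disc. *)
Lemma geometric_limit : (exists n k0 D, geometric_step n k0 D) ->
  exists l : nat -> K, forall n k0 D, geometric_step n k0 D ->
    forall j m, abs (f (k0 + j)%N m - l m) * radius n ^+ m <= D * theta ^+ j.
Proof.
move=> [n [k0 [D hD]]].
have lim m : exists l, forall e : R, 0 < e ->
    exists M, forall k, (M <= k)%N -> abs (f k m - l) < e.
  case: hQp => _ [complete _]; apply: complete => e e0.
  have r0 := exprn_gt0 m (radius_gt0 hQp n).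
  have [j hj] := geometric_lt D ht (mulr_gt0 e0 r0).
  exists (k0 + j)%N => x y hx hy.
  have near z : (k0 + j <= z)%N -> abs (f z m - f (k0 + j)%N m) < e.
    move=> /subnKC <-; rewrite -(ltr_pM2r r0).
    exact: le_lt_trans (geometric_step_tail _ _ _ hD) hj.
  have -> : f x m - f y m = (f x m - f (k0 + j)%N m) - (f y m - f (k0 + j)%N m).
    by rewrite opprB addrA subrK.
  apply: le_lt_trans (absD hQp _ _) _.
  by rewrite (absN hQp) gt_max !near.
have [l hl] := choice lim.
exists l => {hD} n' k0' D' hD j m.
have r0 := exprn_gt0 m (radius_gt0 hQp n').
apply/ler_addgt0Pr => e e0.
have [M hM] := hl m _ (divr_gt0 e0 r0).
have D0 : 0 <= D' * theta ^+ j.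
  by apply: le_trans (hD j m); rewrite mulr_ge0 ?(abs_ge0 hQp) // ltW.
have -> : f (k0' + j)%N m - l m =
    (f (k0' + j + M)%N m - l m) - (f (k0' + j + M)%N m - f (k0' + j)%N m).
  by rewrite opprB [RHS]addrC addrA subrK.
rewrite -ler_pdivlMr //; apply: (absB_le hQp).
  apply/ltW/(lt_le_trans (hM _ (leq_addl _ _))).
  by rewrite ler_pM2r ?invr_gt0 // lerDr.
rewrite ler_pdivlMr //; apply: le_trans (geometric_step_tail _ _ _ hD) _.
by rewrite lerDl ltW.
Qed.

(** By the ultrametric inequality the limit is bounded by the maximum of [B] and a term tending to
    0, so [B] itself persists. *)
Lemma geometric_limit_bound l n k0 D B m :
  (forall j, abs (f (k0 + j)%N m - l) * radius n ^+ m <= D * theta ^+ j) -> 0 <= B ->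
  (forall j, abs (f (k0 + j)%N m) * radius n ^+ m <= B) -> abs l * radius n ^+ m <= B.
Proof.
move=> h1 B0 h2; apply: (le_max_geometric (D := D) ht B0) => j.
have r0 := exprn_gt0 m (radius_gt0 hQp n).
rewrite -[l](subKr (f (k0 + j)%N m)) -ler_pdivlMr //.
by apply: (absB_le hQp); rewrite ler_pdivlMr // le_max ?h1 ?h2 ?orbT.
Qed.

End Sequence.
End Limits.

(** * Specialisation of the indeterminates to the entries of [P] *)

Section Evaluation.
Variables (K : fieldType) (d : nat).
Local Notation I2 := ('I_d.+1 * 'I_d.+1)%type.
Local Notation nvar := #|{: 'I_d.+1 * 'I_d.+1}|.
Local Notation S := (mpoly nvar {poly K}).
Local Notation expo := {ffun 'I_d.+1 * 'I_d.+1 -> 'I_d.+1}.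

Definition multinom_of (mo : expo) : multinom nvar := Multinom [tuple (mo (enum_val i) : nat) | i < nvar].

Definition eval_pt (P : 'M[K]_d.+1) (i : 'I_nvar) : {poly K} :=
  (P (enum_val i).1 (enum_val i).2)%:P.

Lemma wt_gt0 (i : 'I_nvar) : (0 < wt i)%N.
Proof. by rewrite /wt; case: ifP => // h; rewrite subn_gt0. Qed.

(** All weights are at least 1, so exponents and total degree are at most [d]; the variables with
    [b <= a] have weight [d + 1] and must have exponent 0. *)
Lemma mono_of_multinom m : (mwt m <= d)%N ->
  exists mo0 : expo, forall mo, (mono_ok mo && (multinom_of mo == m)) = (mo == mo0).
Proof.
move=> hm; have hi i : (m i * wt i <= d)%N.
  by apply: leq_trans hm; rewrite /mwt (bigD1 i) //= leq_addr.
have hmi i : (m i < d.+1)%N.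
  by rewrite ltnS; apply: leq_trans (hi i); rewrite leq_pmulr // wt_gt0.
pose mo0 : expo := [ffun ij => inord (m (enum_rank ij))].
have e0 : multinom_of mo0 = m by apply/mnmP => i; rewrite mnmE ffunE enum_valK inordK.
exists mo0 => mo; apply/andP/eqP => [[_ /eqP e]|->].
  apply/ffunP => ij; apply: val_inj; rewrite ffunE /= inordK //.
  by rewrite -e mnmE enum_rankK.
split; last exact/eqP.
apply/andP; split.
  apply/forallP => ij; apply/implyP => hij; apply/eqP; apply: val_inj.
  rewrite ffunE /= inordK //; have := hi (enum_rank ij).
  by rewrite /wt enum_rankK ltnNge hij /=; case: (m _) => // x; rewrite mulSn; lia.
apply: leq_trans hm; rewrite /mwt.
rewrite (reindex (@enum_val _ {: I2})) /=; last exact: (onW_bij _ (@enum_val_bij _)).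
apply: leq_sum => i _; rewrite ffunE inordK ?enum_valK //.
by rewrite leq_pmulr // wt_gt0.
Qed.

(** Matches each multinomial of the support with its unique admissible exponent function, giving the
    shape of [poly_eval]. *)
Lemma meval_mono (P : 'M[K]_d.+1) (f : S) :
  (forall m, mcoeff m f != 0 -> (mwt m <= d)%N) ->
  meval (eval_pt P) f =
    \sum_(mo : expo | mono_ok mo) (\prod_(ij : I2) P ij.1 ij.2 ^+ mo ij)%:P * mcoeff (multinom_of mo) f.
Proof.
move=> hf; rewrite mevalE.
pose G m := mcoeff m f * \prod_i eval_pt P i ^+ m i.
have Gmm (mo : expo) : (\prod_(ij : I2) P ij.1 ij.2 ^+ mo ij)%:P * mcoeff (multinom_of mo) f = G (multinom_of mo).
  rewrite /G mulrC; congr (_ * _); rewrite rmorph_prod /=.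
  rewrite (reindex (@enum_val _ {: I2})) /=; last exact: (onW_bij _ (@enum_val_bij _)).
  by apply: eq_bigr => i _; rewrite mnmE /eval_pt rmorphXn.
under [RHS]eq_bigr do rewrite Gmm.
transitivity (\sum_(m <- msupp f) \sum_(mo : expo | mono_ok mo && (multinom_of mo == m)) G m).
  rewrite !big_seq; apply: eq_bigr => m; rewrite mcoeff_msupp => /hf/mono_of_multinom[mo0 h].
  by rewrite (eq_bigl _ _ h) big_pred1_eq.
rewrite (exchange_big_dep (@mono_ok d)) /=; last by move=> m mo _ /andP[].
apply: eq_bigr => mo ok; rewrite (eq_bigl (fun m => m == multinom_of mo)); last first.
  by move=> m; rewrite ok eq_sym.
have [h|h] := boolP (multinom_of mo \in msupp f).
  by rewrite -big_filter filter_pred1_uniq ?msupp_uniq // big_seq1.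
rewrite big_seq_cond big1 => [|m /andP[h1 /eqP e]]; last by rewrite -e h1 in h.
by rewrite /G memN_msupp_eq0 // mul0r.
Qed.

Lemma map_Qgen (P : 'M[K]_d.+1) : (forall i : 'I_d.+1, P i i = 1) ->
  (forall i j : 'I_d.+1, (j < i)%N -> P i j = 0) ->
  map_mx (meval (eval_pt P)) (Qgen K d) = map_mx polyC P^T.
Proof.
move=> P1 P0; apply/matrixP => i j.
rewrite [LHS]mxE [RHS]mxE [P^T i j]mxE.
rewrite [Qgen K d i j]mxE mevalD [Lgen _ _ i j]mxE.
have -> : meval (eval_pt P) ((1 : 'M[S]_d.+1) i j) = (i == j)%:R.
  by rewrite mxE; case: (i == j); rewrite ?meval1 // meval0.
case: (ltngtP j i) => ji.
- rewrite mevalXU /eval_pt enum_rankK /=; case: eqP ji => [->|]; first by rewrite ltnn.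
  by rewrite add0r.
- rewrite meval0 addr0 P0 //; case: eqP ji => [->|]; first by rewrite ltnn.
  by [].
- by rewrite (val_inj ji) eqxx meval0 addr0 P1.
Qed.

End Evaluation.

Section MatrixIdentities.

Lemma conj_chain (T : nzRingType) (n : nat) (E iE X V A D Q iQ : 'M[T]_n) :
  E *m iE = 1%:M ->
  iE *m X *m E *m ((iE *m V *m E) *m ((iE *m iQ) *m D *m (Q *m E)) *m (iE *m A *m E))
  = iE *m (X *m (V *m (iQ *m D *m Q) *m A)) *m E.
Proof.
move=> e; have cE Y : Y *m E *m iE = Y by rewrite -mulmxA e mulmx1.
by rewrite !mulmxA !cE.
Qed.

Lemma conj_diag_exp (K : fieldType) (d : nat) (E F : 'M[K]_d.+1) (D : 'I_d.+1 -> K) n :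
  E \in unitmx -> E *m F = diag_mx (\row_i D i) *m E ->
  F ^+ n = invmx E *m diag_mx (\row_i D i ^+ n) *m E.
Proof.
move=> uE h; have eF : E *m F ^+ n = diag_mx (\row_i D i ^+ n) *m E.
  elim: n => [|n IH].
    rewrite expr0 mulmx1 [diag_mx _](_ : _ = 1%:M) ?mul1mx //.
    by apply/matrixP => i j; rewrite !mxE expr0.
  rewrite exprSr mulmxA IH -mulmxA h mulmxA mulmx_diag; congr (diag_mx _ *m _).
  by apply/rowP => i; rewrite !mxE exprSr.
by rewrite -mulmxA -eF mulKmx.
Qed.

Lemma conj_diag_inv (K : fieldType) (d : nat) (E F : 'M[K]_d.+1) (D : 'I_d.+1 -> K) :
  (forall i, D i != 0) -> F \in unitmx -> E *m F = diag_mx (\row_i D i) *m E ->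
  E *m invmx F = diag_mx (\row_i (D i)^-1) *m E.
Proof.
move=> D0 uF h; rewrite -[RHS](mulmxK uF) -[_ *m E *m F]mulmxA h mulmxA mulmx_diag.
rewrite [diag_mx _](_ : _ = 1%:M) ?mul1mx //; apply/matrixP => i j; rewrite !mxE mulVf //.
Qed.

Lemma invmx_mul (K : fieldType) (n : nat) (A B : 'M[K]_n) :
  A \in unitmx -> B \in unitmx -> invmx (A *m B) = invmx B *m invmx A.
Proof.
move=> uA uB; have uAB : A *m B \in unitmx by rewrite unitmx_mul uA.
by rewrite -[RHS](mulmxK uAB) mulmxA -[_ *m _ *m A]mulmxA mulVmx // mulmx1 mulVmx // mul1mx.
Qed.

Lemma coef_conj (K : fieldType) (m n : nat) (A B : 'M[K]_n) (M : 'M[{poly K}]_n) i j :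
  ((map_mx polyC A *m M *m map_mx polyC B) i j)`_m =
  (A *m (\matrix_(k, l) (M k l)`_m) *m B) i j.
Proof.
rewrite !mxE coef_sum; apply: eq_bigr => l _; rewrite !mxE mulrC mul_polyC coefZ mulrC.
congr (_ * _); rewrite coef_sum; apply: eq_bigr => k _; by rewrite !mxE mul_polyC coefZ.
Qed.

End MatrixIdentities.

(** * The sequence [Z_n] as a specialisation of the generic product *)

Section ZseqEvaluation.
Variables (K : fieldType) (p : nat) (u : K) (d N : nat) (a : int) (len : nat).
Variables (alpha : 'I_d.+1 -> K) (t : 'I_d.+1 -> int).
Variables (Phi Bm E P : 'M[K]_d.+1).
Hypotheses (alpha0 : forall i, alpha i != 0) (uPhi : Phi \in unitmx) (uB : Bm \in unitmx)
  (uE : E \in unitmx) (hE : E *m Phi = diag_mx (\row_i alpha i) *m E)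
  (P1 : forall i : 'I_d.+1, P i i = 1) (P0 : forall i j : 'I_d.+1, (j < i)%N -> P i j = 0)
  (hB : Bm = P^T *m E).

Definition tau_of m (l : 'I_d.+1) : {poly K} := tilde_xi p u m (t l) (t ord_max) a len.

Local Notation ev := (map_mx (meval (eval_pt P))).
Local Notation C := (map_mx polyC).

Lemma unit_PT : P^T \in unitmx.
Proof. by move: uB; rewrite hB unitmx_mul => /andP[]. Qed.

Lemma map_Qinv : ev (Qinv K d) = C (invmx P^T).
Proof.
have h : C P^T *m ev (Qinv K d) = 1%:M.
  by rewrite -(map_Qgen P1 P0) -map_mxM Qgen_Qinv map_mx1.
rewrite -[LHS]mul1mx -(map_mx1 polyC) -(mulVmx unit_PT) map_mxM -mulmxA h.
by rewrite mulmx1.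
Qed.

Lemma map_Agen k : ev (Agen alpha k) = C (diag_mx (\row_i alpha i ^+ k)).
Proof.
rewrite /Agen !map_diag_mx; congr diag_mx; apply/rowP => i.
rewrite !mxE. exact: mevalC.
Qed.

Lemma map_AgenV k : ev (AgenV alpha k) = C (diag_mx (\row_i (alpha i)^-1 ^+ k)).
Proof.
rewrite /AgenV !map_diag_mx; congr diag_mx; apply/rowP => i.
rewrite !mxE; exact: mevalC.
Qed.

Lemma map_Mgen m : ev (Mgen tau_of m) =
  C (invmx P^T) *m diag_mx (\row_i tau_of m i) *m C P^T.
Proof.
rewrite /Mgen !map_mxM map_Qinv (map_Qgen P1 P0) map_diag_mx.
congr (_ *m diag_mx _ *m _); apply/rowP => i; rewrite !mxE; exact: mevalC.
Qed.

(** [Phi = E^-1 A E] and [Bm = P^T E] turn each factor into a conjugate by [E] of the generic one,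
    and the inner [E E^-1] cancel. *)
Lemma Zseq_eval k : Zseq p u Phi Bm t a len N k =
  C (invmx E) *m ev (Xgen N alpha tau_of k) *m C E.
Proof.
elim: k => [|k IH].
  by rewrite /= map_mx1 mulmx1 -map_mxM mulVmx // map_mx1.
rewrite [LHS]/= {}IH [Xgen _ _ _ k.+1]/=; move: (N + k)%N => m.
rewrite (conj_diag_exp _ uE hE) (conj_diag_exp _ uE (conj_diag_inv alpha0 uPhi hE)).
have ev4 (X V M A : 'M[mpoly #|{: 'I_d.+1 * 'I_d.+1}| {poly K}]_d.+1) :
    ev (X *m (V *m M *m A)) = ev X *m (ev V *m ev M *m ev A) by rewrite !map_mxM.
rewrite /Tmat hB invmx_mul ?unit_PT // ev4 map_Mgen map_Agen map_AgenV !map_mxM.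
by apply: conj_chain; rewrite -map_mxM mulmxV // map_mx1.
Qed.

Lemma Zseq_coef k i j m : (Zseq p u Phi Bm t a len N k i j)`_m =
  (invmx E *m (\matrix_(x, y)
     poly_eval (fun mo m' => (mcoeff (multinom_of mo) (Xgen N alpha tau_of k x y))`_m') P m) *m E) i j.
Proof.
rewrite Zseq_eval coef_conj; congr ((_ *m _ *m _) i j); apply/matrixP => x y; rewrite !mxE.
rewrite meval_mono => [|m' h].
  by rewrite coef_sum; apply: eq_bigr => mo _; rewrite coefCM.
(* The weight of the entry [(x, y)] is [x - y], hence at most [d]. *)
have e := graded_Xgen h; have := ltn_ord x; rewrite -e ltnS; apply: leq_trans.
exact: leq_addl.
Qed.

End ZseqEvaluation.

(** * Bounds for the limit *)

Section LimitCoefficients.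
Variables (R : realType) (K : fieldType) (abs : K -> R) (p : nat).
Hypothesis hQp : is_Qp abs p.
Variables (d N : nat) (alpha : 'I_d.+1 -> K) (tau : nat -> 'I_d.+1 -> {poly K}).
Hypothesis alpha0 : forall i, alpha i != 0.
Variables (b Lam q : R) (tauB : 'I_d.+1 -> R).
Hypotheses (hb : forall i j : 'I_d.+1, (j <= i)%N -> abs (alpha j / alpha i) <= b)
  (Lam0 : 0 <= Lam) (hLam1 : forall i, (abs (alpha i))^-1 <= Lam)
  (tau1 : forall m l, gauss_le abs 1 (tauB l) (tau m l))
  (hLam2 : forall i l : 'I_d.+1, (l <= i)%N -> (abs (alpha i))^-1 * tauB l <= Lam)
  (q0 : 0 <= q) (bq : b * q < 1)
  (tau2 : forall n e l, gauss_le abs (radius R p n) (q ^+ e) (tau (n + e).+1 l - 1)).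

Local Notation radius := (radius R p).
Local Notation expo := {ffun 'I_d.+1 * 'I_d.+1 -> 'I_d.+1}.
Local Notation coef k i j mo m := ((mcoeff (multinom_of mo) (Xgen N alpha tau k i j))`_m).

Lemma mulmx_AgenV_entry n (M : 'M[mpoly #|{: 'I_d.+1 * 'I_d.+1}| {poly K}]_d.+1) i j :
  (M *m AgenV alpha n) i j = mpolyC _ ((alpha j)^-1 ^+ n)%:P * M i j.
Proof. by rewrite mul_mx_diag [LHS]mxE [X in _ * X]mxE mulrC. Qed.

(** Limits are taken monomial by monomial in the [lambda_(i,j)], so that [c] is independent of
    [P]. *)
Lemma limit_coefficients :
  exists c : 'I_d.+1 -> 'I_d.+1 -> expo -> nat -> K,
    (forall n, exists k0 D, forall k i j mo m,
       abs (coef (k0 + k)%N i j mo m - c i j mo m) * radius n ^+ m <= D * (b * q) ^+ k) /\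
    (exists2 C : R, 0 <= C & forall n i j mo m,
       abs (c i j mo m) * radius n ^+ m * (abs (alpha j))^-1 ^+ n <= C * Lam ^+ n).
Proof.
have b0 := b_ge0 hQp hb.
have ht : 0 <= b * q < 1 by rewrite mulr_ge0.
have diff := mxgauss_le_Xgen_diff hQp N alpha0 hb Lam0 hLam1 tau1 hLam2 q0 bq tau2.
have [C C0 disc] := mxgauss_le_Xgen_disc hQp N alpha0 hb Lam0 hLam1 tau1 hLam2 q0 bq tau2.
have step (x : 'I_d.+1 * 'I_d.+1 * expo) n k0 D :
    (forall j, mxgauss_le abs (radius n) (D * (b * q) ^+ j)
       (Xgen N alpha tau (k0 + j).+1 - Xgen N alpha tau (k0 + j))) ->
    geometric_step abs p (fun k m => coef k x.1.1 x.1.2 x.2 m) (b * q) n k0 D.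
  move=> h k m; have := h k x.1.1 x.1.2 (multinom_of x.2) m.
  by rewrite !mxE mcoeffB coefB.
have lim (x : 'I_d.+1 * 'I_d.+1 * expo) : exists l : nat -> K, forall n k0 D,
    geometric_step abs p (fun k m => coef k x.1.1 x.1.2 x.2 m) (b * q) n k0 D ->
    forall j m, abs (coef (k0 + j)%N x.1.1 x.1.2 x.2 m - l m) * radius n ^+ m <= D * (b * q) ^+ j.
  apply: (geometric_limit hQp ht (f := fun k m => coef k x.1.1 x.1.2 x.2 m)).
  have [k0 [D hD]] := diff 0%N.
  by exists 0%N, k0, D; apply: step.
have [l hl] := choice lim.
exists (fun i j mo => l (i, j, mo)); split.
  move=> n; have [k0 [D hD]] := diff n; exists k0, D => k i j mo m.
  exact: (hl (i, j, mo) n k0 D (step (i, j, mo) n k0 D hD)).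
exists C => // n i j mo m; have [k0 [D hD]] := diff n.
have aj : 0 < (abs (alpha j))^-1 ^+ n by rewrite exprn_gt0 // invr_gt0 (abs_gt0 hQp).
rewrite -ler_pdivlMr //.
(* Starting at [k1] ensures [n < N + k], as the bound on the disc requires. *)
pose k1 := (n.+1 + k0)%N.
have hD1 : geometric_step abs p (fun k m => coef k i j mo m) (b * q) n k1 D.
  move=> k m'; have h := step (i, j, mo) n k0 D hD (n.+1 + k)%N m'.
  rewrite /= in h; rewrite /k1 [(n.+1 + k0)%N]addnC -addnA; apply: le_trans h _.
  have D0 : 0 <= D.
    have := hD 0%N; move/(mxgauss_le_ge0 hQp); rewrite expr0 mulr1; exact.
  rewrite ler_wpM2l // ler_wiXn2l ?leq_addl //; first exact: mulr_ge0.
  exact: ltW.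
apply: (geometric_limit_bound (f := fun k m => coef k i j mo m) (k0 := k1) hQp ht
  (hl (i, j, mo) n k1 D hD1 ^~ m)).
  by rewrite divr_ge0 ?(ltW aj) // mulr_ge0 // exprn_ge0.
move=> k; rewrite ler_pdivlMr //.
have hk : (n < N + (k1 + k))%N by rewrite /k1; lia.
have := disc _ _ hk i j (multinom_of mo) m; rewrite mulmx_AgenV_entry mcoeffCM coefCM (absM hQp) (absX hQp) (absV hQp).
by rewrite -mulrA mulrC.
Qed.

End LimitCoefficients.

Section Bounds.
Variables (R : realType) (K : fieldType) (abs : K -> R) (p : nat).
Hypothesis hQp : is_Qp abs p.

Definition sumabs m n (M : 'M[K]_(m, n)) : R := \sum_i \sum_j abs (M i j).

Lemma sumabs_ge0 m n (M : 'M[K]_(m, n)) : 0 <= sumabs M.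
Proof. by apply: sumr_ge0 => i _; apply: sumr_ge0 => j _; apply: (abs_ge0 hQp). Qed.

Lemma le_sumabs m n (M : 'M[K]_(m, n)) i j : abs (M i j) <= sumabs M.
Proof.
rewrite /sumabs (bigD1 i) //= (bigD1 j) //= -addrA lerDl.
by rewrite addr_ge0 // ?sumr_ge0 // => k _; rewrite ?sumr_ge0 // ?(abs_ge0 hQp) // => k' _; apply: (abs_ge0 hQp).
Qed.

Lemma abs_mulmx_le l m n (A : 'M[K]_(l, m)) (X : 'M[K]_(m, n)) rho B :
  0 < rho -> 0 <= B -> (forall i j, abs (X i j) * rho <= B) ->
  forall i j, abs ((A *m X) i j) * rho <= sumabs A * B.
Proof.
move=> r0 B0 h i j; rewrite mxE -ler_pdivlMr //; apply: (abs_sum_le hQp).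
  by rewrite divr_ge0 ?(ltW r0) // mulr_ge0 // sumabs_ge0.
move=> k _; rewrite (absM hQp) ler_pdivlMr // -mulrA.
by rewrite ler_pM ?(abs_ge0 hQp) ?le_sumabs // mulr_ge0 ?(abs_ge0 hQp) // ltW.
Qed.

Lemma abs_mulmx_ler l m n (A : 'M[K]_(m, n)) (X : 'M[K]_(l, m)) rho B :
  0 < rho -> 0 <= B -> (forall i j, abs (X i j) * rho <= B) ->
  forall i j, abs ((X *m A) i j) * rho <= B * sumabs A.
Proof.
move=> r0 B0 h i j; rewrite mxE -ler_pdivlMr //; apply: (abs_sum_le hQp).
  by rewrite divr_ge0 ?(ltW r0) // mulr_ge0 // sumabs_ge0.
move=> k _; rewrite (absM hQp) ler_pdivlMr // mulrAC.
by rewrite ler_pM ?(abs_ge0 hQp) ?le_sumabs // mulr_ge0 ?(abs_ge0 hQp) // ltW.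
Qed.

Section PolyEval.
Variables (d : nat) (P : 'M[K]_d.+1).
Local Notation expo := {ffun 'I_d.+1 * 'I_d.+1 -> 'I_d.+1}.

Definition monoabs : R :=
  \sum_(mo : expo) abs (\prod_(ij : 'I_d.+1 * 'I_d.+1) P ij.1 ij.2 ^+ mo ij).

Lemma monoabs_ge0 : 0 <= monoabs.
Proof. by apply: sumr_ge0 => i _; apply: (abs_ge0 hQp). Qed.

Lemma abs_poly_eval_le (c : expo -> nat -> K) m rho B : 0 < rho -> 0 <= B ->
  (forall mo, abs (c mo m) * rho <= B) -> abs (poly_eval c P m) * rho <= monoabs * B.
Proof.
move=> r0 B0 h; rewrite -ler_pdivlMr //; apply: (abs_sum_le hQp).
  by rewrite divr_ge0 ?(ltW r0) // mulr_ge0 // monoabs_ge0.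
move=> mo _; rewrite (absM hQp) ler_pdivlMr // -mulrA.
apply: ler_pM; rewrite ?(abs_ge0 hQp) //; first by rewrite mulr_ge0 ?(abs_ge0 hQp) // ltW.
by rewrite /monoabs (bigD1 mo) //= lerDl sumr_ge0 // => i _; apply: (abs_ge0 hQp).
Qed.

End PolyEval.

Lemma psnorm_le r (f : nat -> K) B :
  (forall k, abs (f k) * r ^+ k <= B) -> psnorm abs r f <= B.
Proof.
by move=> h; apply: ge_sup; [exists (abs (f 0%N) * r ^+ 0), 0%N | move=> x [k _ <-]].
Qed.

Lemma psnorm_ge0 r (f : nat -> K) B : 0 <= r ->
  (forall k, abs (f k) * r ^+ k <= B) -> 0 <= psnorm abs r f.
Proof.
move=> r0 h; apply: (@le_trans _ _ (abs (f 0%N) * r ^+ 0)).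
  by rewrite mulr_ge0 ?(abs_ge0 hQp) // exprn_ge0.
apply: sup_upper_bound; last by exists 0%N.
split; first by exists (abs (f 0%N) * r ^+ 0), 0%N.
by exists B => x [k _ <-].
Qed.

(** Choose [radius n] larger than [r]: the terms are then at most [B (r / radius n)^k]. *)
Lemma inH_bounded (f : nat -> K) :
  (forall n, exists B, forall m, abs (f m) * radius R p n ^+ m <= B) -> inH abs f.
Proof.
move=> h r hr; have [n hn] := radius_to1 hQp hr; have [B hB] := h n.
have [r0 r1] := andP hr; have rn0 := radius_gt0 hQp n.
have ht : 0 <= r / radius R p n < 1 by rewrite divr_ge0 ?ltW //= ltr_pdivrMr // mul1r.
apply: (squeeze_cvgr _ (cvg_cst 0) (geometric_cvg0 B ht)).
near=> k; rewrite mulr_ge0 ?(abs_ge0 hQp) ?exprn_ge0 ?(ltW r0) //=.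
have -> : r ^+ k = radius R p n ^+ k * (r / radius R p n) ^+ k.
  by rewrite -exprMn mulrCA divff ?mulr1 // gt_eqF.
by rewrite mulrA ler_wpM2r // exprn_ge0 //; case/andP: ht.
Unshelve. all: by end_near.
Qed.

Lemma abs_ordp x : x != 0 -> abs x = p%:R `^ (- ordp abs p x).
Proof.
move=> x0; have p1 := Qp_p_gt1 hQp.
rewrite /ordp opprK /powR gt_eqF ?(Qp_p_gt0 hQp) //.
by rewrite divfK ?lnK ?posrE ?(abs_gt0 hQp) // gt_eqF // ln_gt0.
Qed.

End Bounds.

(** * The limit operator in the standard basis *)

Section LimitOperator.
Variables (R : realType) (K : fieldType) (abs : K -> R) (p : nat).
Hypothesis hQp : is_Qp abs p.
Variables (d : nat) (alpha : 'I_d.+1 -> K).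
Local Notation expo := {ffun 'I_d.+1 * 'I_d.+1 -> 'I_d.+1}.
Variables (c : 'I_d.+1 -> 'I_d.+1 -> expo -> nat -> K) (E P : 'M[K]_d.+1).
Hypotheses (alpha0 : forall i, alpha i != 0) (uE : E \in unitmx).

Definition Xinf m : 'M[K]_d.+1 := \matrix_(i, j) poly_eval (c i j) P m.
Definition Zinf i j m : K := (invmx E *m Xinf m *m E) i j.

Lemma mat_in_basis_Zinf i j : mat_in_basis E Zinf i j = poly_eval (c i j) P.
Proof.
apply/funext => m; rewrite /mat_in_basis /Zinf.
have -> : poly_eval (c i j) P m = (E *m (invmx E *m Xinf m *m E) *m invmx E) i j.
  by rewrite !mulmxA mulmxK // mulmxV // mul1mx mxE.
rewrite exchange_big /= mxE; apply: eq_bigr => l _.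
by rewrite mxE big_distrl.
Qed.

Variables (Lam C : R).
Hypotheses (Lam0 : 0 <= Lam) (C0 : 0 <= C)
  (hc : forall n i j mo m,
     abs (c i j mo m) * radius R p n ^+ m * (abs (alpha j))^-1 ^+ n <= C * Lam ^+ n).

Lemma inH_c i j mo : inH abs (c i j mo).
Proof.
apply: (inH_bounded hQp) => n; exists (C * Lam ^+ n / (abs (alpha j))^-1 ^+ n) => m.
have aj : 0 < (abs (alpha j))^-1 ^+ n by rewrite exprn_gt0 // invr_gt0 (abs_gt0 hQp).
by rewrite ler_pdivlMr.
Qed.

Lemma Xinf_diag_le n m i j :
  abs ((Xinf m *m diag_mx (\row_l (alpha l)^-1 ^+ n)) i j) * radius R p n ^+ m <=
    monoabs abs P * (C * Lam ^+ n).
Proof.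
have aj : 0 < (abs (alpha j))^-1 ^+ n by rewrite exprn_gt0 // invr_gt0 (abs_gt0 hQp).
rewrite mul_mx_diag !mxE (absM hQp) (absX hQp) (absV hQp) -mulrA [X in _ * X]mulrC.
apply: (abs_poly_eval_le hQp) => [||mo].
- by rewrite mulr_gt0 // exprn_gt0 // (radius_gt0 hQp).
- by rewrite mulr_ge0 // exprn_ge0.
- by rewrite mulrA.
Qed.

Lemma inH_Zinf i j : inH abs (Zinf i j).
Proof.
apply: (inH_bounded hQp) => n.
exists (sumabs abs (invmx E) *
  (monoabs abs P * (C * Lam ^+ n) * sumabs abs (diag_mx (\row_l alpha l ^+ n) *m E))) => m.
(* Insert [A^(-n) A^n], since the available estimate is for [Xinf] multiplied by [A^(-n)]. *)
have -> : Zinf i j m = (invmx E *m (Xinf m *m diag_mx (\row_l (alpha l)^-1 ^+ n) *m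
                          (diag_mx (\row_l alpha l ^+ n) *m E))) i j.
  rewrite /Zinf -!mulmxA; congr ((_ *m (_ *m _)) i j).
  rewrite mulmxA mulmx_diag [diag_mx _](_ : _ = 1%:M) ?mul1mx //.
  by apply/matrixP => x y; rewrite !mxE -exprMn mulVf // expr1n.
have rn := exprn_gt0 m (radius_gt0 hQp n).
have B0 : 0 <= monoabs abs P * (C * Lam ^+ n).
  by rewrite mulr_ge0 ?(monoabs_ge0 hQp) // mulr_ge0 // exprn_ge0.
apply: (abs_mulmx_le hQp) => //; first by rewrite mulr_ge0 // (sumabs_ge0 hQp).
by apply: (abs_mulmx_ler hQp) => // x y; apply: Xinf_diag_le.
Qed.

Section Convergence.
Variables (Z : nat -> 'I_d.+1 -> 'I_d.+1 -> nat -> K)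
  (ck : nat -> 'I_d.+1 -> 'I_d.+1 -> expo -> nat -> K) (theta : R).
Hypotheses (ht : 0 <= theta < 1)
  (hZ : forall k i j m, Z k i j m =
     (invmx E *m (\matrix_(x, y) poly_eval (ck k x y) P m) *m E) i j)
  (hck : forall n, exists k0 D, forall k i j mo m,
     abs (ck (k0 + k)%N i j mo m - c i j mo m) * radius R p n ^+ m <= D * theta ^+ k).

Lemma psnorm_Z_cvg i j r : 0 < r < 1 ->
  (fun k => psnorm abs r (fun m => Z k i j m - Zinf i j m)) @ \oo --> (0 : R).
Proof.
move=> hr; have [n hn] := radius_to1 hQp hr; have [k0 [D hD]] := hck n.
have [r0 r1] := andP hr.
pose W := sumabs abs (invmx E) * (monoabs abs P * D) * sumabs abs E.
have bound k m : abs (Z (k0 + k)%N i j m - Zinf i j m) * r ^+ m <= W * theta ^+ k.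
  apply: (@le_trans _ _ (abs (Z (k0 + k)%N i j m - Zinf i j m) * radius R p n ^+ m)).
    rewrite ler_wpM2l ?(abs_ge0 hQp) // lerXn2r // ?nnegrE; last exact: ltW.
      exact: ltW.
    by rewrite ltW // (lt_trans r0).
  have -> : Z (k0 + k)%N i j m - Zinf i j m = (invmx E *m
      (\matrix_(x, y) poly_eval (fun mo m' => ck (k0 + k)%N x y mo m' - c x y mo m') P m)
      *m E) i j.
    have -> : \matrix_(x, y) poly_eval (fun mo m' => ck (k0 + k)%N x y mo m' - c x y mo m') P m
       = (\matrix_(x, y) poly_eval (ck (k0 + k)%N x y) P m) - Xinf m.
      apply/matrixP => x y; rewrite !mxE /poly_eval -sumrB; apply: eq_bigr => mo _.
      by rewrite mulrBr.
    by rewrite hZ mulmxBr mulmxBl [RHS]mxE; congr (_ + _); rewrite [RHS]mxE.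
  have B0 : 0 <= D * theta ^+ k.
    (* Any exponent serves here: only the nonnegativity of the bound is extracted. *)
    apply: le_trans (hD k i j [ffun=> ord0] m); rewrite mulr_ge0 ?(abs_ge0 hQp) //.
    by rewrite exprn_ge0 // ltW // (radius_gt0 hQp).
  have rn := exprn_gt0 m (radius_gt0 hQp n).
  have M0 : 0 <= monoabs abs P * (D * theta ^+ k) by rewrite mulr_ge0 ?(monoabs_ge0 hQp).
  have -> : W * theta ^+ k =
     sumabs abs (invmx E) * (monoabs abs P * (D * theta ^+ k)) * sumabs abs E.
    by rewrite /W; ring.
  apply: (abs_mulmx_ler hQp) => //; first by rewrite mulr_ge0 // (sumabs_ge0 hQp).
  apply: (abs_mulmx_le hQp) => // x y; rewrite mxE.
  by apply: (abs_poly_eval_le hQp) => // mo; apply: hD.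
rewrite -(cvg_shiftn k0).
apply: (squeeze_cvgr _ (cvg_cst 0) (geometric_cvg0 W ht)).
near=> k; rewrite /= [(k + k0)%N]addnC (psnorm_le (bound k)) andbT.
by apply: (psnorm_ge0 hQp _ (bound k)); apply: ltW.
Unshelve. all: by end_near.
Qed.

End Convergence.

Variable Phi : 'M[K]_d.+1.
Hypotheses (uPhi : Phi \in unitmx) (hE : E *m Phi = diag_mx (\row_i alpha i) *m E).

(** As [phi^(-n)] acts on the right by [E^-1 A^(-n) E], its diagonal part lands next to [Xinf],
    where [Xinf_diag_le] applies. *)
Lemma phi_inv_pow_span N0 (w : 'I_N0 -> 'rV[K]_d.+1) (lam : 'I_N0 -> nat -> K) n k m :
  phi_inv_pow Phi n (fun l m' => \sum_(i < N0) ps_mul (lam i) (Zapply Zinf (w i) l) m') k m =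
  \sum_(i < N0) \sum_(x < m.+1) lam i x *
    (w i *m invmx E *m (Xinf (m - x) *m diag_mx (\row_l (alpha l)^-1 ^+ n)) *m E) 0 k.
Proof.
rewrite /phi_inv_pow (conj_diag_exp n uE (conj_diag_inv alpha0 uPhi hE)).
set F := invmx E *m _ *m E.
under eq_bigr do rewrite mulr_suml; rewrite exchange_big /=; apply: eq_bigr => i _.
rewrite /ps_mul; under eq_bigr do rewrite mulr_suml; rewrite exchange_big /=.
apply: eq_bigr => x _.
have -> : w i *m invmx E *m (Xinf (m - x) *m diag_mx (\row_l (alpha l)^-1 ^+ n)) *m E
   = w i *m (invmx E *m Xinf (m - x) *m E) *m F.
  by rewrite /F !mulmxA mulmxK.
rewrite [in RHS]mxE mulr_sumr; apply: eq_bigr => l _; rewrite -mulrA; congr (_ * (_ * _)).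
by rewrite /Zapply mxE; apply: eq_bigr => k' _.
Qed.

(** Bounded power series have norm bounded uniformly in [n], the radii being less than 1, so
    [Lambda]-linear combinations keep the growth [Lam ^+ n]. *)
Lemma span_bound g : in_Lam_span abs Zinf g -> exists M : R, forall n,
  psnormv abs (radius R p n) (phi_inv_pow Phi n g) <= M * Lam ^+ n.
Proof.
move=> [N0 [w [lam [hlam ->]]]].
have [M hM] := choice hlam.
have M0 i : 0 <= M i by apply: le_trans (hM i 0%N); apply: (abs_ge0 hQp).
pose B i := sumabs abs (w i *m invmx E) * (monoabs abs P * C) * sumabs abs E.
have B0 i : 0 <= B i.
  by rewrite !mulr_ge0 ?(sumabs_ge0 hQp) ?(monoabs_ge0 hQp).
exists (\sum_i M i * B i) => n.
have L0 : 0 <= Lam ^+ n by rewrite exprn_ge0.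
have T0 : 0 <= (\sum_i M i * B i) * Lam ^+ n.
  by rewrite mulr_ge0 // sumr_ge0 // => i _; rewrite mulr_ge0.
apply: bigmax_le => // k _; apply: psnorm_le => m.
have rn := radius_gt0 hQp n; have rnm := exprn_gt0 m rn.
rewrite phi_inv_pow_span -ler_pdivlMr //; apply: (abs_sum_le hQp) => [|i _].
  by rewrite divr_ge0 // ltW.
apply: (abs_sum_le hQp) => [|x _]; first by rewrite divr_ge0 // ltW.
rewrite ler_pdivlMr // (absM hQp).
have xm : (x <= m)%N by rewrite -ltnS.
have rnmx := exprn_gt0 (m - x) rn.
have h1 : abs (lam i x) * radius R p n ^+ x <= M i.
  apply: le_trans (hM i x); rewrite ler_piMr ?(abs_ge0 hQp) // exprn_ile1 ?(ltW rn) //.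
  exact/ltW/(radius_lt1 hQp).
have MC0 : 0 <= monoabs abs P * (C * Lam ^+ n).
  by rewrite mulr_ge0 ?(monoabs_ge0 hQp) // mulr_ge0.
have h2 : abs ((w i *m invmx E *m (Xinf (m - x) *m diag_mx (\row_l (alpha l)^-1 ^+ n)) *m E) 0 k)
    * radius R p n ^+ (m - x) <= B i * Lam ^+ n.
  have -> : B i * Lam ^+ n =
    sumabs abs (w i *m invmx E) * (monoabs abs P * (C * Lam ^+ n)) * sumabs abs E.
    by rewrite /B; ring.
  apply: (abs_mulmx_ler hQp) => //; first by rewrite mulr_ge0 // (sumabs_ge0 hQp).
  by apply: (abs_mulmx_le hQp) => // x' y'; apply: Xinf_diag_le.
have -> : radius R p n ^+ m = radius R p n ^+ x * radius R p n ^+ (m - x) by rewrite -exprD subnKC.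
rewrite mulrACA; apply: (@le_trans _ _ (M i * (B i * Lam ^+ n))).
  by apply: ler_pM; rewrite // mulr_ge0 ?(abs_ge0 hQp) // ltW // exprn_gt0.
rewrite mulrA ler_wpM2r // (bigD1 i) //= lerDl sumr_ge0 // => y _.
by rewrite mulr_ge0.
Qed.

End LimitOperator.

(** * Choice of the constants and slope of the limit *)

Lemma in_oc_subJ (t0 t1 t2 a j : int) (len : nat) : t0 <= t1 ->
  (forall j, in_oc t0 t2 j -> in_J a len j) -> in_oc t1 t2 j -> in_J a len j.
Proof.
by move=> h hJ /andP[h1 h2]; apply: hJ; rewrite /in_oc h2 (le_lt_trans h h1).
Qed.

Lemma eigenvalues_neq0 (K : fieldType) (d : nat) (alpha : 'I_d.+1 -> K) (E Phi : 'M[K]_d.+1) :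
  E \in unitmx -> Phi \in unitmx -> E *m Phi = diag_mx (\row_i alpha i) *m E ->
  forall i, alpha i != 0.
Proof.
move=> uE uPhi hE i.
have : diag_mx (\row_i alpha i) *m E \in unitmx by rewrite -hE unitmx_mul uE.
rewrite unitmx_mul uE andbT unitmxE det_diag unitfE => /prodf_neq0/(_ i isT).
by rewrite mxE.
Qed.
Unset Implicit Arguments.
Set Strict Implicit.
Set Printing Implicit Defensive.

Theorem mainTheorem12 (R : realType) (K : fieldType) (abs : K -> R) (p : nat)
  (hQp : is_Qp abs p) (hodd : odd p)
  (u : K) (hu : topgen_1pZp abs p u)
  (d : nat) (N : nat) (a : int) (len : nat)
  (alpha : 'I_d.+1 -> K) (t : 'I_d.+1 -> int)
  (ht_dist : forall i j : 'I_d.+1, (i < j)%N -> t i < t j)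
  (hJ : forall j : int, in_oc (t ord0) (t ord_max) j -> in_J a len j)
  (hJlen : forall i j : 'I_d.+1, (i <= j)%N -> ordp abs p (alpha j / alpha i) < len%:R) :
  exists c : 'I_d.+1 -> 'I_d.+1 -> {ffun 'I_d.+1 * 'I_d.+1 -> 'I_d.+1} -> nat -> K,
    (forall i j mo, inH abs (c i j mo)) /\
    forall (Phi : 'M[K]_d.+1) (Fil : int -> 'M[K]_d.+1) (F : 'I_d.+1 -> 'M[K]_d.+1)
           (Bm E P : 'M[K]_d.+1),
      Phi \in unitmx ->
      is_filtration Fil ->
      HT_weights Fil t ->
      is_refinement Phi Fil t F ->
      Bm \in unitmx -> (forall i, (row i Bm <= Fil (t i))%MS) ->
      (forall i, (F i == first_rows Bm i)%MS) ->
      E \in unitmx -> E *m Phi = diag_mx (\row_i alpha i) *m E ->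
      (forall i, (F i == first_rows E i)%MS) ->
      (forall i : 'I_d.+1, P i i = 1) -> (forall i j : 'I_d.+1, (j < i)%N -> P i j = 0) ->
      Bm = P^T *m E ->
      exists Zinf : 'I_d.+1 -> 'I_d.+1 -> nat -> K,
        [/\ forall i j, inH abs (Zinf i j),
            forall i j (r : R), 0 < r < 1 ->
              (fun k => psnorm abs r (fun m =>
                  ps_of_poly (Zseq p u Phi Bm t a len N k i j) m - Zinf i j m)) @ \oo
                --> (0 : R),
            forall i j, mat_in_basis E Zinf i j = poly_eval (c i j) P
          & forall g, in_Lam_span abs Zinf g ->
              (ps_slope abs p Phi (t ord_max) g <=
                 ((((len.-1) %/ p.-1)%N)%:R +
                  \big[Num.max/(ordp abs p (alpha ord0) - (t ord0)%:~R)]_(k < d.+1)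
                    \big[Num.max/(ordp abs p (alpha ord0) - (t ord0)%:~R)]_(i < d.+1 | (i <= k)%N)
                      (ordp abs p (alpha k) - (t i)%:~R))%:E)%E ].
Proof.
set x0 := ordp abs p (alpha ord0) - (t ord0)%:~R.
set mx := \big[Num.max/x0]_(k < d.+1) _.
set s := _%:R + mx.
(* If some [alpha i] is zero no invertible [Phi] has these eigenvalues, and any [c] with entries in
   [H] will do. *)
have [/existsP[i0 /eqP ai0]|] := boolP [exists i, alpha i == 0].
  exists (fun _ _ _ _ => 0); split.
    by move=> i j mo; apply: (inH_bounded hQp) => n; exists 0 => m; rewrite (abs0 hQp) mul0r.
  move=> Phi Fil F Bm E P uPhi _ _ _ _ _ _ uE hE.
  by have := eigenvalues_neq0 uE uPhi hE i0; rewrite ai0 eqxx.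
rewrite negb_exists => /forallP alpha0.
have p1 := Qp_p_gt1 hQp; have p0 := Qp_p_gt0 hQp.
have len0 : (0 < len)%N.
  by have := hJlen ord0 ord0 (leqnn _); rewrite divff // /ordp (abs1 hQp) ln1 mul0r oppr0 ltr0n.
have tle (i j : 'I_d.+1) : (i <= j)%N -> t i <= t j.
  by rewrite leq_eqVlt => /orP[/eqP/val_inj -> //|/ht_dist/ltW].
have tmax l : t l <= t ord_max by apply: tle; rewrite -ltnS.
have sub l j : in_oc (t l) (t ord_max) j -> in_J a len j.
  by apply: in_oc_subJ hJ; apply: tle.
pose beta := (len.-1 %/ p.-1)%N.
pose tauB (l : 'I_d.+1) : R := p%:R ^+ (absz (t ord_max - t l)%R + beta).
have tau1 m l : gauss_le abs 1 (tauB l) (tau_of p u a len t m l).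
  exact: (gauss_le_tilde_xi hQp hodd hu m len0 (tmax l) (sub l)).
pose q : R := p%:R^-1 ^+ len.
have q0 : 0 <= q by rewrite exprn_ge0 // invr_ge0 ltW.
have tau2 n e l : gauss_le abs (radius R p n) (q ^+ e) (tau_of p u a len t (n + e).+1 l - 1).
  by rewrite /q -exprM mulnC; apply: (gauss_le_tilde_xi_sub1 hQp hodd hu n e len0 (tmax l) (sub l)).
pose b : R := \big[Num.max/0]_(i < d.+1) \big[Num.max/0]_(j < d.+1 | (j <= i)%N)
  abs (alpha j / alpha i).
have hb (i j : 'I_d.+1) : (j <= i)%N -> abs (alpha j / alpha i) <= b.
  move=> ji; apply: le_trans (le_bigmax _ _ i).
  exact: le_bigmax_cond.
(* For [j <= i], [|alpha_j / alpha_i| = p^ord(alpha_i / alpha_j) < p^len]: this is the hypothesis on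
   the length of [J]. *)
have bq : b * q < 1.
  rewrite /q exprVn ltr_pdivrMr ?exprn_gt0 // mul1r.
  apply: bigmax_lt => [|i _]; first exact: exprn_gt0.
  apply: bigmax_lt => [|j ji]; first exact: exprn_gt0.
  rewrite (abs_ordp hQp) ?mulf_neq0 ?invr_eq0 // -powR_mulrn ?ltW // /powR gt_eqF // ltr_expR ltr_pM2r ?ln_gt0 //.
  have -> : - ordp abs p (alpha j / alpha i) = ordp abs p (alpha i / alpha j).
    by rewrite /ordp -[alpha j / alpha i]invf_div (absV hQp) lnV ?posrE ?(abs_gt0 hQp) ?mulf_neq0 ?invr_eq0 // mulNr opprK.
  exact: hJlen.
have le_mx (i k : 'I_d.+1) : (i <= k)%N -> ordp abs p (alpha k) - (t i)%:~R <= mx.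
  move=> ik; apply: le_trans (le_bigmax _ _ k).
  exact: le_bigmax_cond.
(* This is the growth allowed by slope [s]; [hLam2] then amounts to [beta + ord(alpha_i) - t_l <= s]
   for [l <= i]. *)
pose Lam : R := p%:R `^ (s + (t ord_max)%:~R).
have Lam_gt0 : 0 < Lam by rewrite powR_gt0.
have Lam0 := ltW Lam_gt0.
have aV i : (abs (alpha i))^-1 = p%:R `^ (ordp abs p (alpha i)).
  by rewrite (abs_ordp hQp) // powRN invrK.
have hLam2 (i l : 'I_d.+1) : (l <= i)%N -> (abs (alpha i))^-1 * tauB l <= Lam.
  move=> li; rewrite aV /tauB -powR_mulrn ?(ltW p0) // -powRD; last by rewrite (gt_eqF p0) implybT.
  rewrite ler_powR ?(ltW p1) // natrD.
  have -> : (absz (t ord_max - t l)%R)%:R = (t ord_max)%:~R - (t l)%:~R :> R.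
    by rewrite -intrB pmulrn gez0_abs ?subr_ge0 ?tmax.
  have := le_mx _ _ li; rewrite /s -/beta; lra.
have hLam1 i : (abs (alpha i))^-1 <= Lam.
  apply: le_trans (hLam2 i i (leqnn _)); rewrite ler_peMr ?invr_ge0 ?(abs_ge0 hQp) //.
  by rewrite exprn_ege1 // ltW.
(* [c] is fixed here, before the filtered module, its bases and [P] are introduced. *)
have [c [hc1 [C C0 hc2]]] := limit_coefficients hQp N alpha0 hb Lam0 hLam1 tau1 hLam2 q0 bq tau2.
have ht : 0 <= b * q < 1 by rewrite bq mulr_ge0 // (b_ge0 hQp hb).
exists c; split; first exact: (inH_c hQp alpha0 hc2).
move=> Phi Fil F Bm E P uPhi _ _ _ uB _ _ uE hE _ P1 P0 hB.
exists (Zinf c E P); split.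
- exact: (inH_Zinf hQp E P alpha0 Lam0 C0 hc2).
- move=> i j r hr.
  exact: (psnorm_Z_cvg hQp ht (Zseq_coef p u N a len t alpha0 uPhi uB uE hE P1 P0 hB) hc1).
- by move=> i j; apply: mat_in_basis_Zinf.
move=> g hg; apply: ereal_inf_lbound; exists s => //=.
have [M hM] := span_bound hQp alpha0 uE Lam0 C0 hc2 uPhi hE hg.
(* With [rho = 1/p] the radii in the definition of the slope are the [radius n]. *)
exists p%:R^-1; split; first by rewrite invr_gt0 p0 invf_lt1.
exists M => n; rewrite mulNr powRN powRrM powR_mulrn //.
by rewrite ler_pdivrMl ?exprn_gt0 // mulrC; apply: hM.
Qed.
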